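(* Let $d$ be a real number with $0 < d < 1$, and let $\mathbf{D} \in \mathcal{F}(d)$ be an arbitrary disk-polygon with center parameter $d$ in the Euclidean plane $\mathbb{E}^2$. Then the area of $\mathbf{D}$ is strictly larger than the area of $\Delta^{\circ}(d)$, i.e. $$a(\mathbf{D}) > a(\Delta^{\circ}(d)).$$
   Context: A disk-polygon is an intersection, with non-empty interior, of finitely many closed circular disks of unit radius in the Euclidean plane $\mathbb{E}^2$. Whenever a disk-polygon is considered, the disks generating it (its generating disks) are assumed to be all needed: each of them contributes to the boundary of the disk-polygon through a circular arc (called a side), and consecutive sides meet in the vertices of the disk-polygon. For $0<d<\sqrt{3}$, a disk-polygon $\mathbf{D}$ is called a disk-polygon with center parameter $d$ if the distance between any two centers of the generating disks of $\mathbf{D}$ is at most $d$. $\mathcal{F}(d)$ denotes the family of all disk-polygons with center parameter $d$. A convex domain is a compact convex set with non-empty interior in $\mathbb{E}^2$. For a convex domain $\mathbf{C}$ and $\rho>0$, the outer parallel domain $\mathbf{C}_\rho$ of radius $\rho$ of $\mathbf{C}$ is the union of all closed circular disks of radius $\rho$ whose centers belong to $\mathbf{C}$. The Reuleaux triangle of width $w$ is the intersection of the three closed circular disks of radius $w$ centered at the vertices of an equilateral triangle of side length $w$. For $0<d<1$, $\Delta^{\circ}(d)$ denotes the outer parallel domain of radius $1-d$ of a Reuleaux triangle of width $d$. $a(\cdot)$ denotes area. *)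

(* Defs.v *)
From mathcomp Require Import all_boot all_order all_algebra.
From mathcomp Require Import all_classical all_reals all_analysis.
Set Implicit Arguments.
Unset Strict Implicit.
Unset Printing Implicit Defensive.
Import Order.TTheory GRing.Theory Num.Theory.
Import numFieldNormedType.Exports.
Local Open Scope classical_set_scope.
Local Open Scope ring_scope.

Section DiskPolygons.
Variable R : realType.
Implicit Types (p q c : R * R) (r w d : R) (A C D T : set (R * R)).

(* The library norm on [R * R] is the max norm. It induces the usual topology
   of the plane, but not the Euclidean distance. *)
Definition edist p q : R := Num.sqrt ((p.1 - q.1) ^+ 2 + (p.2 - q.2) ^+ 2).

Definition disk r c : set (R * R) := [set p | edist c p <= r].

Definition boundary A : set (R * R) := closure A `\` interior A.

Definition arc r c (a b : R) : set (R * R) :=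
  [set (c.1 + r * cos t, c.2 + r * sin t) | t in `[a, b]].

Definition area A : \bar R := (@lebesgue_measure R \x @lebesgue_measure R)%E A.

(* [C] is the set of centers of the generating disks of the disk-polygon [D].
   The nonemptiness of [C] excludes the empty intersection, which is the whole
   plane. The last clause says that every generating disk is needed: it
   contributes a nondegenerate circular arc to the boundary. *)
Definition disk_polygon_with_centers C D : Prop :=
  [/\ finite_set C, C !=set0, D = \bigcap_(c in C) disk 1 c,
      interior D !=set0 &
      forall c, C c -> exists a b : R, a < b /\ arc 1 c a b `<=` boundary D].

Definition disk_polygons_with_center_parameter d : set (set (R * R)) :=
  [set D | exists2 C, disk_polygon_with_centers C D &
           forall c c', C c -> C c' -> edist c c' <= d].

Definition outer_parallel_domain r A : set (R * R) := \bigcup_(c in A) disk r c.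

Definition reuleaux_triangle w T : Prop :=
  exists p q c, [/\ edist p q = w, edist q c = w, edist c p = w &
                    T = disk w p `&` disk w q `&` disk w c].

(* [A] is a copy of the domain Delta^o(d), which is determined by [d] only up to
   congruence. *)
Definition rounded_reuleaux d A : Prop :=
  exists2 T, reuleaux_triangle d T & A = outer_parallel_domain (1 - d) T.

End DiskPolygons.

(* Main.v *)
Require Import Defs.
From mathcomp Require Import all_boot all_order all_algebra.
From mathcomp Require Import all_classical all_reals all_analysis.
From mathcomp Require Import measurable_realfun ring lra.
Import Order.TTheory GRing.Theory Num.Theory.
Import numFieldNormedType.Exports.
Local Open Scope classical_set_scope.
Local Open Scope ring_scope.

(** Write [s = 1 - d], let [C] be the set of centers of the generating disks of [D],
and let [B] be the unit disk. Both areas are compared with the number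
[pi (1 - d) + (pi - sqrt 3) d^2 / 2].

Lower bound. Extend [C] to a set [K] that is maximal among the sets of diameter at
most [d] ([diametric_completion]). Such a set is convex and compact, and it has
constant width [d]: for every unit vector [u] it contains two points that differ by
[d u] ([complete_constant_width]). By the triangle inequality the outer parallel
domain [K + s B] lies in [D], so it suffices to bound the area of [K + s B] from
below. All areas of Minkowski sums come from one computation: adding a segment to a
convex body adds the length of the segment times the width of the body across it, by
Cavalieri's principle ([area_minkowski_sum_segment]). It is used twice.

- The disk of radius [t] contains sums of segments of total length close to [pi t],
  namely the regular polygons with an even number of sides. Hence adding that disk to
  a body of width at least [w] in every direction adds at least [pi t w]
  ([rarea_minkowski_sum_ball]). Repeating this with small radii gives Steiner's
  inequality, [a(K + s B) >= a(K) + pi (d s + s^2)] ([rarea_parallel_body]).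

- The Blaschke-Lebesgue inequality [a(K) >= (pi - sqrt 3) d^2 / 2] follows from
  Chakerian's argument ([blaschke_lebesgue]). Turning a circumscribed equiangular
  hexagon until it is regular shows that [K] lies in a regular hexagon [H] of width
  [d]. As [H] is centrally symmetric, [- K] also lies in a translate of [H]. Since
  [K - K] contains [d B], for [0 < t < 1] the body [(1 - t) K + t d B] lies in
  [K - t K], hence in a translate of [K + t H]. The first body has area at least
  [(1 - t)^2 a(K) + pi d^2 t (1 - t)]. The hexagon is a sum of three segments, so the
  last one has area at most [a(K) + sqrt 3 d^2 t + O(t^2)]. Compare the terms of order
  [t].

Strictness. Some point of [D] is outside [K + s B] ([area_disk_polygon_gt]). Suppose
not, and take an arc of the boundary of [D] on the unit circle around a center [c].
If [c + u] is a point of the arc, it belongs to [K + s B], and being at distance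
[1 = d + s] from [c] it forces [c + d u] to belong to [K]. As [C] is finite, some
[c + d u] is not in [C]; then [c - s u] is at distance less than [1] from all of [C],
so [D] contains points slightly beyond it, while all points of [K + s B] are at
distance at most [1] from [c + d u].

Upper bound. Cut the plane along the side lines of the triangle spanned by the
vertices of the Reuleaux triangle. The outer parallel domain is covered by the triangle, by
the parts outside the triangle of the three sectors of angle [pi / 3] and radius [1]
at its vertices that contain it, and by the three opposite sectors of radius [s]
([area_rounded_reuleaux]). *)

Set Implicit Arguments.
Unset Strict Implicit.

(** * Behavior of the area under affine maps *)

Section Area.
Variable R : realType.
Local Notation mu := (@lebesgue_measure R).
Implicit Types (X Y : set (R * R)) (a b c : R).

(** The measurable sets of the plane are generated by rectangles, so an open set is
written as a countable union of rational squares. *)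
Lemma open_measurable_plane X : open X -> measurable X.
Proof.
move=> oX.
pose bx (q : rat * rat * rat) : set (R * R) :=
  `]ratr q.1.1 - ratr q.2 : R, ratr q.1.1 + ratr q.2[%classic `*`
  `]ratr q.1.2 - ratr q.2 : R, ratr q.1.2 + ratr q.2[%classic.
have -> : X = \bigcup_q (if `[< bx q `<=` X >] then bx q else set0).
  apply/seteqP; split=> [[x y] Xxy|z [q _]]; last by case: asboolP => // + /[dup] bz; apply.
  have /nbhs_ballP[e /= e0 beX] : nbhs (x, y) X by rewrite openE in oX; exact: oX.
  have [r rin] : exists r : rat, ratr r \in `]0 : R, e / 2[.
    by apply: rat_in_itvoo; rewrite divr_gt0.
  have [p pin] : exists p : rat, ratr p \in `]x - ratr r : R, x + ratr r[.
    by apply: rat_in_itvoo; move: rin; rewrite in_itv/=; lra.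
  have [q qin] : exists q : rat, ratr q \in `]y - ratr r : R, y + ratr r[.
    by apply: rat_in_itvoo; move: rin; rewrite in_itv/=; lra.
  move: rin pin qin; rewrite !in_itv/= => rin pin qin.
  exists (p, q, r) => //; case: asboolP => [_|[]].
    by split; rewrite /= in_itv/=; lra.
  move=> -[x' y'] [/=]; rewrite !in_itv/= => x'in y'in; apply: beX.
  by split; rewrite /ball/= ltr_norml; lra.
apply: (@countable_bigcupT_measurable _ _ (rat * rat * rat)%type) => [|q]; first exact: countableP.
case: ifP => // _.
by apply: measurableX; exact: measurable_itv.
Qed.

Lemma closed_measurable_plane X : closed X -> measurable X.
Proof. by move/closed_openC/open_measurable_plane/measurableC; rewrite setCK. Qed.

(** Both sides are measures in [A] that agree on half-open intervals. *)
Lemma lebesgue_measure_affine (a b : R) (A : set R) : 0 < a -> measurable A ->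
  (mu A = a%:E * mu ((fun x => (a * x + b)%R) @^-1` A))%E.
Proof.
move=> a0 mA.
have mf : measurable_fun setT
    (fun x : measurableTypeR R => (a * x + b : measurableTypeR R)).
  apply: continuous_measurable_fun => x; apply: cvgD; last exact: cvg_cst.
  by apply: cvgM; [exact: cvg_cst|exact: cvg_id].
pose nu := measure_function_pushforward__canonical__measure_function_Measure mu mf.
pose nu' : {measure set (measurableTypeR R) -> \bar R} := mscale (NngNum (ltW a0)) nu.
rewrite (lebesgue_measure_unique (mu := nu')) //.
move=> _ [[x y] _ <-]; have E : (fun u : R => a * u + b) @^-1` `]x, y]%classic =
          `](x - b) / a, (y - b) / a]%classic.
  by apply/seteqP; split=> u /=; rewrite !in_itv/= ltr_pdivrMr// ler_pdivlMr//; lra.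
change (mu `]x, y]%classic =
  a%:E * mu ((fun u : R => (a * u + b)%R) @^-1` `]x, y]%classic))%E; rewrite E.
rewrite !lebesgue_measure_itv/= !lte_fin ltr_pM2r ?invr_gt0// ltrD2r.
case: ifP => _; last by rewrite mule0.
by rewrite -!EFinB -EFinM; congr (_%:E); field; rewrite gt_eqF.
Qed.

Lemma measurable_fiber_affine a b c :
  measurable_fun setT (fun p : R * R => (p.1, a * p.2 + b * p.1 + c)).
Proof.
apply: measurable_fun_pair; first exact: measurable_fst.
have ml (k : R) : measurable_fun setT (fun x : R => k * x).
  apply: continuous_measurable_fun => x.
  by apply: cvgM; [exact: cvg_cst|exact: cvg_id].
apply: measurable_funD => //.
apply: measurable_funD.
  by apply: (measurableT_comp (ml a)); exact: measurable_snd.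
by apply: (measurableT_comp (ml b)); exact: measurable_fst.
Qed.

(** On each vertical line the map is affine of ratio [a]. Translations, dilations and
shears are compositions of maps of this form and of the swapped form. *)
Lemma area_fiber_affine a b c X : 0 < a -> measurable X ->
  (area X = a%:E * area ((fun p => (p.1, (a * p.2 + b * p.1 + c)%R)) @^-1` X))%E.
Proof.
move=> a0 mX; rewrite /area /product_measure1.
have mX' : measurable ((fun p : R * R => (p.1, a * p.2 + b * p.1 + c)) @^-1` X).
  by rewrite -[X in measurable X]setTI; exact: measurable_fiber_affine.
rewrite -ge0_integralZl//; last 2 first.
- by apply: measurable_fun_xsection.
- by rewrite lee_fin ltW.
apply: eq_integral => x _ /=.
rewrite (lebesgue_measure_affine (b * x + c) a0); last exact: measurable_xsection.
congr (_ * mu _)%E; apply/seteqP; split=> y /=; rewrite /xsection/= !inE/= addrA //.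
Qed.

(** This is the symmetry of the product of two measures, that is Fubini's theorem. *)
Lemma area_swap X : measurable X -> area ((fun p : R * R => (p.2, p.1)) @^-1` X) = area X.
Proof.
move=> mX; rewrite /area [RHS](product_measure_unique (m' := (mu \x^ mu)%E))//.
  by move=> A B mA mB; exact: product_measure2E.
Qed.

Lemma measurable_swap_pair : measurable_fun setT (fun p : R * R => (p.2, p.1)).
Proof.
by apply: measurable_fun_pair; [exact: measurable_snd|exact: measurable_fst].
Qed.

Lemma measurable_preimage (f : R * R -> R * R) X :
  measurable_fun setT f -> measurable X -> measurable (f @^-1` X).
Proof. by move=> mf mX; rewrite -[X in measurable X]setTI; exact: mf. Qed.

Lemma area_fiber_affine_swap a b c X : 0 < a -> measurable X ->
  (area X = a%:E * area ((fun p => ((a * p.1 + b * p.2 + c)%R, p.2)) @^-1` X))%E.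
Proof.
move=> a0 mX; rewrite -(area_swap mX) (area_fiber_affine b c a0); last first.
  exact: (measurable_preimage measurable_swap_pair).
congr (_ * _)%E; rewrite -[RHS]area_swap//.
rewrite [X in measurable X](_ : _ = (fun p => (p.2, p.1)) @^-1`
  ((fun p => (p.1, a * p.2 + b * p.1 + c)) @^-1` ((fun p => (p.2, p.1)) @^-1` X))) //.
apply: (measurable_preimage measurable_swap_pair).
apply: (measurable_preimage (measurable_fiber_affine a b c)).
exact: (measurable_preimage measurable_swap_pair).
Qed.

Lemma measurable_fiber_affine_swap a b c :
  measurable_fun setT (fun p : R * R => (a * p.1 + b * p.2 + c, p.2)).
Proof.
have := measurableT_comp measurable_swap_pair
  (measurableT_comp (measurable_fiber_affine a b c) measurable_swap_pair).
exact.
Qed.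

Definition rotation (p q : R) (x : R * R) : R * R :=
  (p * x.1 - q * x.2, q * x.1 + p * x.2).

Lemma area_translate (v : R * R) X : measurable X ->
  area ((fun x => x + v) @^-1` X) = area X.
Proof.
move=> mX; rewrite [RHS](area_fiber_affine 0 v.2 ltr01 mX) mul1e.
rewrite [RHS](area_fiber_affine_swap 0 v.1 ltr01); last first.
  exact: (measurable_preimage (measurable_fiber_affine 1 0 v.2)).
rewrite mul1e; congr area; apply/seteqP; split=> -[x y] /=;
  by rewrite !mul1r !mul0r !addr0.
Qed.

Lemma area_scale a X : 0 < a -> measurable X ->
  (area X = (a ^+ 2)%:E * area ((fun x => a *: x) @^-1` X))%E.
Proof.
move=> a0 mX; rewrite (area_fiber_affine 0 0 a0 mX).
rewrite (area_fiber_affine_swap 0 0 a0); last first.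
  exact: (measurable_preimage (measurable_fiber_affine a 0 0)).
rewrite muleA -EFinM -expr2; congr (_ * area _)%E.
by apply/seteqP; split=> -[x y] /=; rewrite !mul0r !addr0.
Qed.

(** A rotation other than the half-turn is a product of three shears, and the half-turn
is the square of a quarter-turn. *)
Lemma area_rotation p q X : p ^+ 2 + q ^+ 2 = 1 -> measurable X ->
  measurable (rotation p q @^-1` X) /\ area (rotation p q @^-1` X) = area X.
Proof.
have H p' q' Y : q' != 0 -> p' ^+ 2 + q' ^+ 2 = 1 -> measurable Y ->
    measurable (rotation p' q' @^-1` Y) /\ area (rotation p' q' @^-1` Y) = area Y.
  move=> q0 pq mY; pose u := (p' - 1) / q'.
  have m1 := measurable_preimage (measurable_fiber_affine_swap 1 u 0) mY.
  have m2 := measurable_preimage (measurable_fiber_affine 1 q' 0) m1.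
  have m3 := measurable_preimage (measurable_fiber_affine_swap 1 u 0) m2.
  have E : rotation p' q' @^-1` Y = (fun p => (1 * p.1 + u * p.2 + 0, p.2)) @^-1`
    ((fun p => (p.1, 1 * p.2 + q' * p.1 + 0)) @^-1`
    ((fun p => (1 * p.1 + u * p.2 + 0, p.2)) @^-1` Y)).
    have uq : u * q' = p' - 1 by rewrite /u divfK.
    have uq2 : u * (p' + 1) = - q'.
      by apply: (mulIf q0); rewrite mulrAC uq; nra.
    suff -> : rotation p' q' = fun x => (x.1 + u * x.2 + u * (x.2 + q' * (x.1 + u * x.2)),
        x.2 + q' * (x.1 + u * x.2)).
      by apply/seteqP; split=> x /=; rewrite !mul1r !addr0.
    apply/funext => -[x y]; rewrite /rotation/=; congr pair.
      have -> : x + u * y + u * (y + q' * (x + u * y)) =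
        (u * q' + 1) * x + u * (u * q' + 1 + 1) * y by ring.
      by rewrite uq subrK uq2; ring.
    have -> : y + q' * (x + u * y) = q' * x + (u * q' + 1) * y by ring.
    by rewrite uq subrK.
  rewrite E; split=> //.
  by rewrite [RHS](area_fiber_affine_swap u 0 ltr01 mY) mul1e
    [RHS](area_fiber_affine q' 0 ltr01 m1) mul1e
    [RHS](area_fiber_affine_swap u 0 ltr01 m2) mul1e.
move=> pq mX; have [q0|] := eqVneq q 0; last by move=> /H; apply.
have [p1|p1] := eqVneq p 1.
  suff -> : rotation p q = id by [].
  by apply/funext => -[x y]; rewrite /rotation q0 p1/= !mul1r !mul0r subr0 add0r.
have pE : p = -1.
  apply/eqP; rewrite -addr_eq0; move: pq; rewrite q0 expr0n addr0 => /eqP.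
  by rewrite -subr_eq0 subr_sqr_1 mulf_eq0 subr_eq0 (negbTE p1).
have [m1 e1] := H 0 1 X (oner_neq0 _) ltac:(by rewrite expr0n expr1n add0r) mX.
have [m2 e2] := H 0 1 _ (oner_neq0 _) ltac:(by rewrite expr0n expr1n add0r) m1.
suff -> : rotation p q @^-1` X = rotation 0 1 @^-1` (rotation 0 1 @^-1` X) by rewrite e2 e1.
by apply/seteqP; split=> -[x y] /=; rewrite /rotation q0 pE/= !mulN1r !mul0r !mul1r;
   rewrite !(add0r, sub0r, subr0, addr0).
Qed.

End Area.

(** * Convex bodies and the addition of a segment *)

Section Bodies.
Variable R : realType.
Local Notation mu := (@lebesgue_measure R).
Implicit Types (X Y : set (R * R)) (x y z u v : R * R) (a b c t w l : R).

Definition cvx X := forall x y t, X x -> X y -> 0 <= t <= 1 ->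
  X ((1 - t) *: x + t *: y).

Definition minkowski_sum X Y : set (R * R) := [set z | exists2 x, X x & exists2 y, Y y & z = x + y].

(** The segment is centered at the origin and has length [2 |v|]. *)
Definition segment v : set (R * R) := [set s *: v | s in `[-1, 1]].

Lemma compact_measurable_plane X : compact X -> measurable X.
Proof.
by move=> cX; apply: closed_measurable_plane; exact: compact_closed (@norm_hausdorff _ _) cX.
Qed.

Lemma compact_minkowski_sum X Y : compact X -> compact Y -> compact (minkowski_sum X Y).
Proof.
move=> cX cY.
rewrite (_ : minkowski_sum X Y = [set z.1 + z.2 | z in X `*` Y]); last first.
  apply/seteqP; split=> [z [x Xx [y Yy ->]]|_ [[x y] /= [Xx Yy] <-]]; first by exists (x, y).
  by exists x => //; exists y.
apply: continuous_compact; last exact: compact_setX.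
apply: continuous_subspaceT => -[x y].
by apply: cvgD; [exact: cvg_fst|exact: cvg_snd].
Qed.

Lemma cvx_minkowski_sum X Y : cvx X -> cvx Y -> cvx (minkowski_sum X Y).
Proof.
move=> cX cY _ _ t [x Xx [y Yy ->]] [x' Xx' [y' Yy' ->]] t01.
exists ((1 - t) *: x + t *: x'); first exact: cX.
exists ((1 - t) *: y + t *: y'); first exact: cY.
by rewrite !scalerDr addrACA.
Qed.

Lemma compact_segment v : compact (segment v).
Proof.
apply: continuous_compact; last exact: segment_compact.
by apply: continuous_subspaceT => x; exact: scalel_continuous.
Qed.

Lemma cvx_segment v : cvx (segment v).
Proof.
move=> _ _ t [a + <-] [b + <-] t01; rewrite /= !in_itv/= => a1 b1.
exists ((1 - t) * a + t * b); first by rewrite /= in_itv/=; nra.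
by congr pair => /=; rewrite /GRing.scale/=; ring.
Qed.

Lemma rotationK p q : p ^+ 2 + q ^+ 2 = 1 -> cancel (@rotation R p q) (rotation p (- q)).
Proof.
move=> pq [x y]; rewrite /rotation/=; congr pair.
  by rewrite -[RHS]mul1r -pq; ring.
by rewrite -[RHS]mul1r -pq; ring.
Qed.

Lemma continuous_rotation p q : continuous (@rotation R p q).
Proof.
move=> [x y]; rewrite /rotation /continuous_at.
apply: (cvg_pair (G := nbhs _) (H := nbhs _)) => /=.
  apply: cvgB; apply: cvgM; try exact: cvg_cst; [exact: cvg_fst|exact: cvg_snd].
apply: cvgD; apply: cvgM; try exact: cvg_cst; [exact: cvg_fst|exact: cvg_snd].
Qed.

Lemma rotationD p q x y : rotation p q (x + y) = rotation p q x + rotation p q y.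
Proof. by rewrite /rotation/=; congr pair => /=; ring. Qed.

Lemma rotationZ p q a x : rotation p q (a *: x) = a *: rotation p q x.
Proof. by rewrite /rotation/=; congr pair => /=; rewrite /GRing.scale/=; ring. Qed.

Lemma compact_interval (A : set R) : A !=set0 -> compact A -> is_interval A ->
  exists a b, [/\ A a, A b & A = `[a, b]%classic].
Proof.
move=> A0 cA iA.
have [|b bA bmax] := @compact_EVT_max _ _ id A A0 cA.
  by apply: continuous_subspaceT => x; exact: cvg_id.
have [|a aA amin] := @compact_EVT_min _ _ id A A0 cA.
  by apply: continuous_subspaceT => x; exact: cvg_id.
rewrite inE in aA; rewrite inE in bA.
exists a, b; split=> //; apply/seteqP; split=> x /=; rewrite in_itv/=.
  by move=> Ax; rewrite amin ?inE// bmax ?inE.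
by move=> xab; exact: iA xab.
Qed.

Lemma lebesgue_measure_segment a b : a <= b -> mu `[a, b]%classic = (b - a)%:E.
Proof.
move=> ab; rewrite lebesgue_measure_itv/= lte_fin; case: ltgtP ab => // -> _.
by rewrite subrr.
Qed.

(** Adding a vertical segment lengthens every non-empty vertical section by [2 l], and
the abscissas of the non-empty sections form the interval from [y.1] to [x.1]. *)
Lemma area_minkowski_sum_vsegment X l : X !=set0 -> compact X -> cvx X -> 0 <= l ->
  exists x y, [/\ X x, X y, forall z, X z -> y.1 <= z.1 <= x.1 &
   area (minkowski_sum X (segment (0, l))) = (area X + (2 * l * (x.1 - y.1))%:E)%E].
Proof.
move=> X0 cX vX l0.
have [b [a [Pb Pa PE]]] : exists b a, [/\ (fst @` X) b, (fst @` X) a & fst @` X = `[a, b]%classic].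
  have [||//|a [b [? ? ?]]] := compact_interval (A := fst @` X); last by exists b, a.
  - by case: X0 => x; exists x.1; exists x.
  - apply: continuous_compact cX; apply: continuous_subspaceT => -[x y]; exact: cvg_fst.
  - move=> _ _ [x Xx <-] [y Xy <-] s /andP[xs sy].
    have [e|ne] := eqVneq x.1 y.1.
      by exists x => //; apply/eqP; rewrite eq_le xs/= e sy.
    have xy : x.1 < y.1 by rewrite lt_neqAle ne (le_trans xs).
    exists ((1 - (s - x.1) / (y.1 - x.1)) *: x + ((s - x.1) / (y.1 - x.1)) *: y).
      apply: vX => //; rewrite divr_ge0 ?subr_ge0//=; last exact: ltW.
      by rewrite ler_pdivrMr ?subr_gt0// mul1r lerD2r.
    by rewrite /= /GRing.scale/=; field; rewrite subr_eq0 gt_eqF.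
case: Pb PE => x Xx <-; case: Pa => y Xy <- PE {a b}.
have yx z : X z -> y.1 <= z.1 <= x.1.
  move=> Xz; have : `[y.1, x.1]%classic z.1 by rewrite -PE; exists z.
  by rewrite /= in_itv.
exists x, y; split=> //.
have mX := compact_measurable_plane cX.
have mS : measurable (minkowski_sum X (segment (0, l))).
  by apply: compact_measurable_plane; apply: compact_minkowski_sum => //; exact: compact_segment.
rewrite /area /product_measure1.
have -> : (2 * l * (x.1 - y.1))%:E = (\int[mu]_s ((2 * l)%:E * (\1_`[y.1, x.1] s)%:E))%E.
  rewrite ge0_integralZl//; last 2 first.
  - exact: measurableT_comp.
  - by rewrite lee_fin mulr_ge0.
  rewrite integral_indic// setIT EFinM.
  by congr (_ * _)%E; apply/esym/lebesgue_measure_segment; case/andP: (yx y Xy).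
rewrite -ge0_integralD//=; last 3 first.
- exact: measurable_fun_xsection.
- by move=> s _; rewrite mule_ge0// ?lee_fin// mulr_ge0.
- by apply: measurable_funeM; exact: measurableT_comp.
apply: eq_integral => s _ /=.
rewrite indicE; have [sP|sP] := boolP (s \in `[y.1, x.1]%classic); last first.
  rewrite mule0 adde0; congr (mu _).
  have H t : ~ X (s, t).
    by move=> Xst; move/negP: sP; apply; rewrite inE -PE; exists (s, t).
  apply/seteqP; split=> t; rewrite /xsection/= inE; last by move/H.
  move=> [[z1 z2] Xz [_ [k _ <-]]] [E _].
  by case: (H z2); rewrite E /GRing.scale/= mulr0 addr0.
rewrite mule1.
have [c [e [Ac Ae AE]]] : exists c e, [/\ X (s, c), X (s, e) & xsection X s = `[c, e]%classic].
  have xsE t : xsection X s t = X (s, t) by rewrite /xsection/= inE.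
  have [|||c [e [Ac Ae AE]]] := compact_interval (A := xsection X s).
  - by move: sP; rewrite inE -PE => -[[z1 z2] Xz /= e]; exists z2; rewrite xsE -e.
  - apply: (@subclosed_compact _ _ (snd @` X)).
    + have -> : xsection X s = (fun t => (s, t)) @^-1` X by apply/funext => t; rewrite xsE.
      apply: closed_comp; last exact: compact_closed (@norm_hausdorff _ _) cX.
      move=> t _; apply: (cvg_pair (G := nbhs _) (H := nbhs _)) => /=; first exact: cvg_cst.
      exact: cvg_id.
    + apply: continuous_compact cX; apply: continuous_subspaceT => -[? ?]; exact: cvg_snd.
    + by move=> t; rewrite xsE => Xt; exists (s, t).
  - move=> t1 t2; rewrite !xsE => X1 X2 t /andP[t1t tt2].
    have [et|ne] := eqVneq t1 t2.
      by rewrite xsE (_ : t = t1)//; apply/eqP; rewrite eq_le t1t et tt2.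
    have t12 : t1 < t2 by rewrite lt_neqAle ne (le_trans t1t).
    have := vX _ _ ((t - t1) / (t2 - t1)) X1 X2.
    rewrite xsE (_ : _ + _ = (s, t)); last first.
      by congr pair => /=; rewrite /GRing.scale/=; field; rewrite subr_eq0 gt_eqF.
    apply; rewrite divr_ge0 ?subr_ge0//=; last exact: ltW.
    by rewrite ler_pdivrMr ?subr_gt0// mul1r lerD2r.
  by exists c, e; split; rewrite -?xsE.
have ce : c <= e.
  have : `[c, e]%classic c by rewrite -AE /xsection/= inE.
  by rewrite /= in_itv/= => /andP[].
rewrite [in RHS]AE lebesgue_measure_segment//.
have -> : xsection (minkowski_sum X (segment (0, l))) s = `[c - l, e + l]%classic.
  apply/seteqP; split=> t; rewrite /xsection/= inE/= in_itv/=.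
    move=> [[z1 z2] Xz [_ [k + <-] [E ->]]]; rewrite /= in_itv/= => k1.
    move: E; rewrite {1}/GRing.scale/= mulr0 addr0 => E.
    have : `[c, e]%classic z2 by rewrite -AE /xsection/= inE E.
    by rewrite /= in_itv/= /GRing.scale/=; nra.
  move=> tce.
  pose r := Num.min (Num.max t c) e.
  have rce : c <= r <= e by rewrite /r; case: (leP t c) => ?; [case: (leP c e)|case: (leP t e)] => ?; lra.
  have tr : - l <= t - r <= l.
    by rewrite /r; case: (leP t c) => ?; [case: (leP c e)|case: (leP t e)] => ?; lra.
  exists (s, r).
    have : `[c, e]%classic r by rewrite /= in_itv.
    by rewrite -AE /xsection/= inE.
  have [l00|l00] := eqVneq l 0.
    exists 0; first by exists 0; rewrite ?scale0r//= in_itv/=; lra.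
    by rewrite addr0; congr pair; lra.
  have lp : 0 < l by rewrite lt_neqAle eq_sym l00.
  exists (((t - r) / l) *: (0, l)).
    by exists ((t - r) / l) => //=; rewrite in_itv/= ler_pdivlMr// ler_pdivrMr//; lra.
  by congr pair => /=; rewrite /GRing.scale/=; field.
rewrite lebesgue_measure_segment; last by lra.
by rewrite -EFinD; congr (_%:E); ring.
Qed.

Definition dot x y := x.1 * y.1 + x.2 * y.2.
Definition sq x := dot x x.
(** The clockwise quarter-turn. *)
Definition perp x : R * R := (x.2, - x.1).

Definition body X := [/\ X !=set0, compact X & cvx X].

Lemma body_minkowski_sum X Y : body X -> body Y -> body (minkowski_sum X Y).
Proof.
move=> [[x Xx] cX vX] [[y Yy] cY vY]; split; last 2 first.
- exact: compact_minkowski_sum.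
- exact: cvx_minkowski_sum.
by exists (x + y); exists x => //; exists y.
Qed.

Lemma body_segment v : body (segment v).
Proof.
split; [|exact: compact_segment|exact: cvx_segment].
by exists 0; exists 0; rewrite ?scale0r//= in_itv/=; lra.
Qed.

(** The rotation that makes [u] vertical turns [dot (perp u)] into the abscissa and
reduces this to the vertical case. *)
Lemma area_minkowski_sum_segment X u l : body X -> sq u = 1 -> 0 <= l ->
  exists x y, [/\ X x, X y,
   forall z, X z -> dot (perp u) y <= dot (perp u) z <= dot (perp u) x &
   area (minkowski_sum X (segment (l *: u))) =
   (area X + (2 * l * (dot (perp u) x - dot (perp u) y))%:E)%E].
Proof.
move=> [X0 cX vX] u1 l0.
have pq : u.2 ^+ 2 + u.1 ^+ 2 = 1 by rewrite -u1 /sq/dot; ring.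
have pq' : u.2 ^+ 2 + (- u.1) ^+ 2 = 1 by rewrite sqrrN.
have fg := rotationK pq; have gf := rotationK pq'; rewrite opprK in gf.
set f := rotation u.2 u.1 in fg gf; set g := rotation u.2 (- u.1) in fg gf.
have fE x : (f x).1 = dot (perp u) x by rewrite /f/rotation/dot/perp/=; ring.
have fu : l *: f u = (0, l).
  rewrite -[X in _ = (0, X)]mulr1 -pq /f /rotation.
  by congr pair; rewrite /= /GRing.scale/=; ring.
have im Y : f @` Y = g @^-1` Y.
  apply/seteqP; split=> [_ [x Yx <-]|z Yz]; first by rewrite /= fg.
  by exists (g z).
have [||||_ [_ [[x Xx <-] [y Xy <-] yx aE]]] := @area_minkowski_sum_vsegment (f @` X) l.
- by case: X0 => x Xx; exists (f x); exists x.
- by apply: continuous_compact cX; apply: continuous_subspaceT; exact: continuous_rotation.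
- move=> _ _ t [x Xx <-] [y Xy <-] t01.
  exists ((1 - t) *: x + t *: y); first exact: vX.
  by rewrite /f rotationD !rotationZ.
- exact: l0.
exists x, y; rewrite -!fE; split=> // [z Xz|].
  by rewrite -fE; apply: yx; exists z.
have mS : measurable (minkowski_sum X (segment (l *: u))).
  by apply: compact_measurable_plane; apply: compact_minkowski_sum => //; exact: compact_segment.
have mX := compact_measurable_plane cX.
rewrite -(area_rotation pq' mS).2 -(area_rotation pq' mX).2 -!im -aE.
congr area; apply/seteqP; split=> [_ [_ [a Xa [_ [s s1 <-] ->]] <-]|].
  exists (f a); first by exists a.
  exists (s *: (0, l)); first by exists s.
  by rewrite -fu /f rotationD !rotationZ.
move=> _ [_ [a Xa <-] [_ [s s1 <-] ->]].
exists (a + s *: (l *: u)); first by exists a => //; exists (s *: (l *: u)) => //; exists s.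
by rewrite -fu /f rotationD !rotationZ.
Qed.

Lemma area_fin X : compact X -> (0 <= area X < +oo)%E.
Proof.
move=> cX; have [->|/set0P X0] := eqVneq X set0.
  by rewrite /area measure0 lexx ltry.
apply/andP; split; first exact: measure_ge0.
have Hx : {within X, continuous (fun x : R * R => x.1)}.
  by apply: continuous_subspaceT => -[? ?]; exact: cvg_fst.
have Hy : {within X, continuous (fun x : R * R => x.2)}.
  by apply: continuous_subspaceT => -[? ?]; exact: cvg_snd.
have [a _ aP] := compact_EVT_min X0 cX Hx.
have [b _ bP] := compact_EVT_max X0 cX Hx.
have [c _ cP] := compact_EVT_min X0 cX Hy.
have [e _ eP] := compact_EVT_max X0 cX Hy.
apply: (@le_lt_trans _ _ (area (`[a.1, b.1]%classic `*` `[c.2, e.2]%classic))).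
  rewrite /area; apply: le_measure; rewrite ?inE.
  - exact: compact_measurable_plane.
  - by apply: measurableX; exact: measurable_itv.
  - by move=> x /mem_set Xx; split; rewrite /= in_itv/= ?aP ?bP ?cP ?eP.
rewrite /area product_measure1E; [|exact: measurable_itv|exact: measurable_itv].
have L r s : exists k, mu `[r, s]%classic = k%:E.
  by rewrite lebesgue_measure_itv/=; case: ifP => _; eexists; rewrite -?EFinB.
have [r1 E1] := L a.1 b.1; have [r2 E2] := L c.2 e.2.
by change (mu `[a.1, b.1]%classic * mu `[c.2, e.2]%classic < +oo)%E; rewrite E1 E2 -EFinM ltry.
Qed.

(** The area as a real number, which is faithful on compact sets by [rareaE]. *)
Definition rarea X : R := fine (area X).

Lemma rareaE X : compact X -> area X = (rarea X)%:E.
Proof. by move=> /area_fin /andP[a0 ai]; rewrite /rarea fineK// ge0_fin_numE. Qed.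

Lemma rarea_le X Y : compact X -> compact Y -> X `<=` Y -> rarea X <= rarea Y.
Proof.
move=> cX cY XY; rewrite -lee_fin -!rareaE//; rewrite /area; apply: le_measure; rewrite ?inE//;
exact: compact_measurable_plane.
Qed.

Lemma rarea_minkowski_sum_segment_ge X u l w : body X -> sq u = 1 -> 0 <= l ->
  (exists x y, [/\ X x, X y & w <= dot (perp u) (x - y)]) ->
  rarea X + 2 * l * w <= rarea (minkowski_sum X (segment (l *: u))).
Proof.
move=> bX u1 l0 [x [y [Xx Xy wxy]]]; have [_ cX _] := bX.
have [x' [y' [Xx' Xy' H E]]] := area_minkowski_sum_segment bX u1 l0.
have := E; rewrite rareaE; last by apply: compact_minkowski_sum => //; exact: compact_segment.
rewrite (rareaE cX) -EFinD => -[->]; rewrite lerD2l ler_wpM2l ?mulr_ge0//.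
by have := H _ Xx; have := H _ Xy; move: wxy; rewrite /dot/=; lra.
Qed.

Lemma rarea_minkowski_sum_segment_le X u l w : body X -> sq u = 1 -> 0 <= l ->
  (forall x y, X x -> X y -> dot (perp u) (x - y) <= w) ->
  rarea (minkowski_sum X (segment (l *: u))) <= rarea X + 2 * l * w.
Proof.
move=> bX u1 l0 Hw; have [_ cX _] := bX.
have [x' [y' [Xx' Xy' H E]]] := area_minkowski_sum_segment bX u1 l0.
have := E; rewrite rareaE; last by apply: compact_minkowski_sum => //; exact: compact_segment.
rewrite (rareaE cX) -EFinD => -[->]; rewrite lerD2l ler_wpM2l ?mulr_ge0//.
by have := Hw _ _ Xx' Xy'; rewrite /dot/=; lra.
Qed.

End Bodies.

(** * Approximation of a disk by zonogons *)

Section Zonogon.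
Variable R : realType.
Implicit Types (X Y : set (R * R)) (x y z u v : R * R) (a b c t w l h : R).

(** Every passage to the limit in an inequality below goes along [1 / n], with an explicit
error term. *)
Lemma le_of_harmonic a k c : (forall n : nat, a - k / n.+1%:R <= c) -> a <= c.
Proof.
move=> H; apply/ler_addgt0Pr => e e0.
have := archi_boundP (divr_ge0 (normr_ge0 k) (ltW e0)).
set n := Num.bound _ => kn; have := H n.
rewrite lerBlDr => /le_trans; apply; rewrite lerD2l.
rewrite ler_pdivrMr ?ltr0n// (le_trans (ler_norm k))//.
move: kn; rewrite ltr_pdivrMr// => kn; apply: (le_trans (ltW kn)).
by rewrite mulrC ler_pM2l// ler_nat.
Qed.

Lemma sin_ge_quad t : 0 <= t <= pi / 2 -> t - t ^+ 2 <= sin t.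
Proof.
move=> t0; have [t00 t1] := andP t0.
have sinle (s : R) : 0 <= s -> 1 - s <= cos s.
  move=> s0.
  have [|c _ e] := @MVT_segment R cos (fun r => - sin r) 0 s s0 (fun r _ => is_derive_cos r).
    by apply: continuous_subspaceT; exact: continuous_cos.
  move: e; rewrite cos0 subr0 => e.
  have := sin_le1 c; have := sin_geN1 c; nra.
have [|c] := @MVT_segment R sin cos 0 t t00 (fun r _ => is_derive_sin r).
  by apply: continuous_subspaceT; exact: continuous_sin.
rewrite sin0 !subr0 in_itv/= => /andP[c0 ct] ->.
have := sinle c c0; nra.
Qed.

(** The absolute values telescope on both sides of the summit [m]. *)
Lemma variation_unimodal (g : nat -> R) (m n : nat) : (m <= n)%N ->
  (forall k, (k < m)%N -> g k <= g k.+1) ->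
  (forall k, (m <= k < n)%N -> g k.+1 <= g k) ->
  \sum_(0 <= k < n) `|g k.+1 - g k| = 2 * g m - g 0 - g n.
Proof.
move=> mn up dn; rewrite (big_cat_nat (leq0n m) mn)//=.
rewrite (eq_big_nat _ _ (F2 := fun k => g k.+1 - g k)); last first.
  by move=> k /andP[_ km]; rewrite ger0_norm// subr_ge0 up.
rewrite telescope_sumr//.
rewrite (eq_big_nat _ _ (F2 := fun k => - (g k.+1 - g k))); last first.
  by move=> k kmn; rewrite ler0_norm// subr_le0 dn.
by rewrite sumrN telescope_sumr//; ring.
Qed.

Definition dir a : R * R := (cos a, sin a).

Lemma sq_dir a : sq (dir a) = 1.
Proof. by rewrite /sq/dot/dir/= -!expr2 cos2Dsin2. Qed.

Lemma dotdir u a : dot u (dir a) = u.1 * cos a + u.2 * sin a.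
Proof. by []. Qed.

Lemma dot_le u v : dot u v <= Num.sqrt (sq u) * Num.sqrt (sq v).
Proof.
have s0 x : 0 <= sq x by rewrite /sq/dot addr_ge0// -expr2 sqr_ge0.
rewrite -sqrtrM// (le_trans (ler_norm _))// -sqrtr_sqr ler_wsqrtr//.
by rewrite /sq/dot -subr_ge0 (_ : _ - _ = (u.1 * v.2 - u.2 * v.1) ^+ 2) ?sqr_ge0//; ring.
Qed.

(** The directions [dir (2 h k)] with [k < n] turn through less than a half-turn, so the
scalar product with [u] changes sign at most once: a direction between two others is
a positive combination of them. *)
Lemma sign_pattern u h (n : nat) : (0 < n)%N -> h = pi / (2 * n%:R) ->
  0 <= dot u (dir 0) -> exists2 m, (m <= n)%N &
  (forall k, (k < m)%N -> 0 <= dot u (dir (2 * h * k%:R))) /\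
  (forall k, (m <= k < n)%N -> dot u (dir (2 * h * k%:R)) <= 0).
Proof.
move=> n0 hE a0; set a := fun k : nat => dot u (dir (2 * h * k%:R)).
have nR : 0 < n%:R :> R by rewrite ltr0n.
have hn : 2 * h * n%:R = pi by rewrite hE; field; rewrite gt_eqF.
have h0 : 0 < h by rewrite hE divr_gt0 ?pi_gt0// mulr_gt0.
have spos k : (0 < k < n)%N -> 0 < sin (2 * h * k%:R).
  move=> /andP[k0 kn]; apply: sin_gt0_pi.
  by rewrite mulr_gt0 ?ltr0n ?mulr_gt0//= -hn ltr_pM2l ?mulr_gt0// ltr_nat.
have [/existsP[k0 ak0]|] := boolP [exists k : 'I_n, a k < 0]; last first.
  rewrite negb_exists => /forallP H; exists n => //; split=> k kn.
    by have := H (Ordinal kn); rewrite -leNgt.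
  by move: kn; case: ltngtP.
have ex : exists k, (k < n)%N && (a k < 0) by exists k0; rewrite ltn_ord.
case: (ex_minnP ex) => m /andP[mn am] mmin; exists m; first exact: ltnW.
split=> k.
  move=> km; rewrite leNgt; apply/negP => ak.
  by have := mmin k; rewrite ak (ltn_trans km mn) => /(_ isT); rewrite leqNgt km.
rewrite leq_eqVlt => /andP[/orP[/eqP<-|mk] kn]; first exact: ltW.
rewrite leNgt; apply/negP => ak.
have m0 : (0 < m)%N.
  by case: (m) am => //; rewrite /a mulr0 => ?; lra.
have : sin (2 * h * k%:R) * a m =
  sin (2 * h * (k - m)%:R) * dot u (dir 0) + sin (2 * h * m%:R) * a k.
  rewrite /a /dot /dir/= cos0 sin0 natrB; last exact: ltnW.
  by rewrite mulrBr sinB; ring.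
have sk := spos k; have sm := spos m; have skm := spos (k - m)%N.
have {}sk : 0 < sin (2 * h * k%:R) by apply: sk; rewrite kn (ltn_trans m0 mk).
have {}sm : 0 < sin (2 * h * m%:R) by apply: sm; rewrite m0.
have {}skm : 0 < sin (2 * h * (k - m)%:R).
  by apply: skm; rewrite subn_gt0 mk (leq_ltn_trans (leq_subr _ _) kn).
rewrite -/(a k) in ak.
by nra.
Qed.

(** The vectors [2 (sin h) dir (2 h k)] are the consecutive edges of a half of a regular
polygon with [2 n] sides inscribed in the unit circle. The sum is half the total
variation of the linear form [dot u] along this half, from a vertex to the opposite
one. This form is unimodal there by [sign_pattern], and it is bounded by [|u|] on the
vertices. *)
Lemma sum_abs_dot u h (n : nat) : (0 < n)%N -> h = pi / (2 * n%:R) ->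
  sin h * (\sum_(0 <= k < n) `|dot u (dir (2 * h * k%:R))|) <= Num.sqrt (sq u).
Proof.
wlog a0 : u / 0 <= dot u (dir 0).
  move=> H n0 hE; have [/H|/ltW a0] := leP 0 (dot u (dir 0)); first exact.
  have := H (- u); have -> : sq (- u) = sq u by rewrite /sq/dot/= !mulrNN.
  have E v : dot (- u) v = - dot u v by rewrite /dot/=; ring.
  rewrite E oppr_ge0 => /(_ a0 n0 hE).
  by under eq_bigr do rewrite E normrN.
move=> n0 hE.
have nR : 0 < n%:R :> R by rewrite ltr0n.
have hn : 2 * h * n%:R = pi by rewrite hE; field; rewrite gt_eqF.
have h0 : 0 < h by rewrite hE divr_gt0 ?pi_gt0// mulr_gt0.
have sh : 0 <= sin h.
  apply: sin_ge0_pi; rewrite (ltW h0)/= -hn -[leLHS]mulr1 -mulrA mulrCA ler_pM2l//.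
  have : 1 <= n%:R :> R by rewrite ler1n.
  lra.
have [m mn [up dn]] := sign_pattern n0 hE a0.
pose q (k : nat) : R * R := (sin (2 * h * k%:R - h), - cos (2 * h * k%:R - h)).
pose g (k : nat) := u.1 * sin (2 * h * k%:R - h) + u.2 * - cos (2 * h * k%:R - h).
(* g k is the value of dot u at the vertex q k of the polygon *)
have gE k : g k.+1 - g k = 2 * sin h * dot u (dir (2 * h * k%:R)).
  rewrite /g dotdir -[k.+1%:R]natr1.
  have -> : 2 * h * (k%:R + 1) - h = 2 * h * k%:R + h by ring.
  by rewrite sinD cosD sinB cosB; ring.
have sq1 k : sq (q k) = 1 by rewrite /sq/dot/q/= mulrNN -!expr2 addrC cos2Dsin2.
have gn : g n = - g 0.
  rewrite /g hn mulr0 sub0r sinN cosN.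
  by rewrite cosB sinB cospi sinpi; ring.
have gup k : (k < m)%N -> g k <= g k.+1.
  by move=> km; rewrite -subr_ge0 gE mulr_ge0 ?mulr_ge0// up.
have gdn k : (m <= k < n)%N -> g k.+1 <= g k.
  by move=> km; rewrite -subr_le0 gE mulr_ge0_le0 ?mulr_ge0// dn.
have := variation_unimodal mn gup gdn; rewrite gn.
under eq_bigr do rewrite gE normrM ger0_norm ?mulr_ge0//.
rewrite -mulr_sumr.
have gm : g m <= Num.sqrt (sq u) by have := dot_le u (q m); rewrite sq1 sqrtr1 mulr1.
move=> E; apply: le_trans gm; rewrite -(ler_pM2l (ltr0n R 2)) mulrA E.
by rewrite opprK subrK.
Qed.

Lemma dotZr u a v : dot u (a *: v) = a * dot u v.
Proof. by rewrite /dot/= /GRing.scale/=; ring. Qed.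

Lemma dotDr u v z : dot u (v + z) = dot u v + dot u z.
Proof. by rewrite /dot/=; ring. Qed.

Lemma sq_ge0 u : 0 <= sq u.
Proof. by rewrite /sq/dot addr_ge0// -expr2 sqr_ge0. Qed.

(** If [S] is the sum, then [|S|^2] is the sum of the terms [lam k * dot S (dir _)], which
[sum_abs_dot] bounds by [|S| / sin h]. *)
Lemma sq_zonogon h (n : nat) (lam : nat -> R) : (0 < n)%N -> h = pi / (2 * n%:R) ->
  (forall k, `|lam k| <= 1) -> 0 <= sin h ->
  sin h * Num.sqrt (sq (\sum_(0 <= k < n) lam k *: dir (2 * h * k%:R))) <= 1.
Proof.
move=> n0 hE lam1 sh; set S := \sum_(_ <= _ < _) _.
have := sum_abs_dot S n0 hE; set r := Num.sqrt (sq S) => H.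
have r0 : 0 <= r by exact: sqrtr_ge0.
have : r * r <= \sum_(0 <= k < n) `|dot S (dir (2 * h * k%:R))|.
  rewrite -expr2 sqr_sqrtr ?sq_ge0// /sq {2}/S.
  rewrite (big_morph (dot S) (dotDr S) (id1 := 0)); last by rewrite /dot/= !mulr0 addr0.
  apply: ler_sum => k _; rewrite dotZr (le_trans (ler_norm _))// normrM.
  by rewrite ler_piMl.
move=> H2; have [->|rn0] := eqVneq r 0; first by rewrite mulr0.
have rp : 0 < r by rewrite lt_neqAle eq_sym rn0.
rewrite -(ler_pM2r rp) mul1r; apply: le_trans H; rewrite -mulrA.
by rewrite ler_wpM2l.
Qed.

(** [X] plus [k] segments of half-length [l], whose directions are [2 h] apart. *)
Definition zonogon X l h := fix zonogon (k : nat) : set (R * R) :=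
  if k is k'.+1 then minkowski_sum (zonogon k') (segment (l *: dir (2 * h * k'%:R))) else X.

(** The width of [X] is at least [w] in every direction. *)
Definition wide w X := forall u, sq u = 1 -> exists x y, [/\ X x, X y & w <= dot u (x - y)].

Lemma wideS w X Y : X `<=` Y -> wide w X -> wide w Y.
Proof. by move=> XY wX u /wX [x [y [Xx Xy ?]]]; exists x, y; split=> //; exact: XY. Qed.

Lemma segment0 v : segment v 0.
Proof. by exists 0; rewrite ?scale0r//= in_itv/=; lra. Qed.

Lemma sub_zonogon X l h k : X `<=` zonogon X l h k.
Proof.
elim: k => [//|k IH] x /IH Xx /=; exists x => //; exists 0; last by rewrite addr0.
exact: segment0.
Qed.

Lemma body_zonogon X l h k : body X -> body (zonogon X l h k).
Proof. by move=> bX; elim: k => //= k IH; apply: body_minkowski_sum => //; exact: body_segment. Qed.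

Lemma sq_perp u : sq (perp u) = sq u.
Proof. by rewrite /sq/dot/perp/=; ring. Qed.

Lemma rarea_zonogon X l h w k : body X -> wide w X -> 0 <= l ->
  rarea X + 2 * l * w * k%:R <= rarea (zonogon X l h k).
Proof.
move=> bX wX l0; elim: k => [|k IH]; first by rewrite mulr0 addr0.
rewrite -[k.+1%:R]natr1 mulrDr mulr1 addrA /=.
apply: le_trans (rarea_minkowski_sum_segment_ge (w := w) (body_zonogon l h k bX) (sq_dir _) l0 _).
  by rewrite lerD2r.
by apply: wideS wX _ _; [exact: sub_zonogon|rewrite sq_perp sq_dir].
Qed.

Lemma zonogon_sub X l h k z : zonogon X l h k z -> exists2 x, X x &
  exists2 lam : nat -> R, (forall i, `|lam i| <= 1) &
   z = x + l *: \sum_(0 <= i < k) lam i *: dir (2 * h * i%:R).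
Proof.
elim: k z => [|k IH] z /=.
  by move=> Xz; exists z => //; exists (fun=> 0) => [_|]; rewrite ?normr0// big_geq// scaler0 addr0.
move=> [x /IH[x0 Xx0 [lam lam1 ->]]] [_ [s + <-] ->]; rewrite /= in_itv/= => s1.
exists x0 => //; exists (fun i => if i == k then s else lam i).
  by move=> i; case: ifP => // _; rewrite ler_norml.
rewrite big_nat_recr//= eqxx -addrA; congr (_ + _).
rewrite scalerDr !scalerA [s * l]mulrC; congr (_ + _); congr (_ *: _).
by apply: eq_big_nat => i /andP[_ ik]; rewrite ltn_eqF.
Qed.

Definition disk0 t : set (R * R) := [set x | sq x <= t ^+ 2].

Lemma continuous_sq : continuous (@sq R).
Proof.
move=> x; rewrite /sq /dot; apply: cvgD; apply: cvgM;
by [exact: cvg_fst|exact: cvg_snd].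
Qed.

Lemma body_disk0 t : 0 <= t -> body (disk0 t).
Proof.
move=> t0; split.
- by exists 0; rewrite /disk0/=/sq/dot/= !mulr0 addr0 sqr_ge0.
- apply: (@subclosed_compact _ _ (`[-t, t]%classic `*` `[-t, t]%classic)).
  + apply: (@closed_comp _ _ (@sq R) [set r | r <= t ^+ 2]); last exact: closed_le.
    by move=> x _; exact: continuous_sq.
  + by apply: compact_setX; exact: segment_compact.
  + by move=> [x y]; rewrite /disk0/=/sq/dot/= !in_itv/= => H; split; nra.
- move=> x y s; rewrite /disk0 /= => Bx By s01.
  have -> : sq ((1 - s) *: x + s *: y) = (1 - s) * sq x + s * sq y - s * (1 - s) * sq (x - y).
    by rewrite /sq/dot/= /GRing.scale/=; ring.
  have [s0 s1] : 0 <= s /\ 0 <= 1 - s by lra.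
  have := mulr_ge0 (mulr_ge0 s0 s1) (sq_ge0 (x - y)).
  have := ler_wpM2l s0 By; have := ler_wpM2l s1 Bx.
  by lra.
Qed.

(** With [h = pi / (2 n)] and [l = t sin h], the sum of [n] segments lies in the disk of
radius [t] by [sq_zonogon], and it adds at least [2 n t (sin h) w] to the area, which
tends to [pi t w]. *)
Lemma rarea_minkowski_sum_ball X w t : body X -> wide w X -> 0 <= t -> 0 <= w ->
  rarea X + pi * t * w <= rarea (minkowski_sum X (disk0 t)).
Proof.
move=> bX wX t0 w0.
suff H (n : nat) : pi * t * w - (pi ^+ 2 / 2 * t * w) / n.+1%:R <=
    rarea (minkowski_sum X (disk0 t)) - rarea X.
  by have := le_of_harmonic H; lra.
pose h : R := pi / (2 * n.+1%:R).
have nR : 0 < n.+1%:R :> R by rewrite ltr0n.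
have n1 : 1 <= n.+1%:R :> R by rewrite ler1n.
have pi0 := pi_gt0 R.
have h0 : 0 <= h <= pi / 2.
  by rewrite /h divr_ge0 ?pi_ge0//= ler_pM2l// lef_pV2 ?posrE// ?mulr_gt0//; lra.
have sh : 0 <= sin h.
  by apply: sin_ge0_pi; move: h0; lra.
have l0 : 0 <= t * sin h by exact: mulr_ge0.
have sub : zonogon X (t * sin h) h n.+1 `<=` minkowski_sum X (disk0 t).
  move=> _ /zonogon_sub [x Xx [lam lam1 ->]]; exists x => //; eexists; last by [].
  rewrite /disk0/=.
  have := sq_zonogon (ltn0Sn n) erefl lam1 sh; set S := \sum_(_ <= _ < _) _ => H.
  have -> : sq ((t * sin h) *: S) = t ^+ 2 * (sin h * Num.sqrt (sq S)) ^+ 2.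
    by rewrite exprMn sqr_sqrtr ?sq_ge0// /sq/dot/= /GRing.scale/=; ring.
  rewrite ler_piMr ?sqr_ge0// expr_le1// mulr_ge0// sqrtr_ge0//.
have := rarea_zonogon h n.+1 bX wX l0.
have cM : compact (minkowski_sum X (disk0 t)) by have [] := body_minkowski_sum bX (body_disk0 t0).
have cZ : compact (zonogon X (t * sin h) h n.+1) by have [] := body_zonogon (t * sin h) h n.+1 bX.
have := rarea_le cZ cM sub.
set A := rarea (zonogon _ _ _ _) => A1 A2.
rewrite lerBrDl; apply: le_trans A1; apply: le_trans A2; rewrite lerD2l.
have -> : pi * t * w - (pi ^+ 2 / 2 * t * w) / n.+1%:R = (t * w * (2 * n.+1%:R)) * (h - h ^+ 2).
  by rewrite /h; field; rewrite gt_eqF.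
have -> : 2 * (t * sin h) * w * n.+1%:R = (t * w * (2 * n.+1%:R)) * sin h by ring.
by rewrite ler_wpM2l ?sin_ge_quad// !mulr_ge0.
Qed.

End Zonogon.

(** * Bodies of constant width and the Blaschke-Lebesgue inequality *)

Section ConstantWidth.
Variable R : realType.
Implicit Types (X Y K : set (R * R)) (x y z u v o : R * R) (a b c t w l h d s : R).

Lemma sub_minkowski_sum_ball X t : X `<=` minkowski_sum X (disk0 t).
Proof.
move=> x Xx; exists x => //; exists 0; last by rewrite addr0.
by rewrite /disk0/=/sq/dot/= !mulr0 addr0 sqr_ge0.
Qed.

Lemma sqD_le x y a b : 0 <= a -> 0 <= b -> sq x <= a ^+ 2 -> sq y <= b ^+ 2 ->
  sq (x + y) <= (a + b) ^+ 2.
Proof.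
move=> a0 b0 xa yb.
have -> : sq (x + y) = sq x + sq y + 2 * dot x y by rewrite /sq/dot/=; ring.
have : dot x y <= a * b.
  apply: le_trans (dot_le x y) _; apply: ler_pM; rewrite ?sqrtr_ge0//.
    by rewrite -(ger0_norm a0) -sqrtr_sqr ler_wsqrtr.
  by rewrite -(ger0_norm b0) -sqrtr_sqr ler_wsqrtr.
by lra.
Qed.

Lemma minkowski_sum_ballD X a b : 0 <= a -> 0 <= b ->
  minkowski_sum (minkowski_sum X (disk0 a)) (disk0 b) `<=` minkowski_sum X (disk0 (a + b)).
Proof.
move=> a0 b0 _ [_ [x Xx [y By ->]] [z Bz ->]]; exists x => //.
by exists (y + z); rewrite ?addrA//; exact: sqD_le.
Qed.

Lemma wide_minkowski_sum_ball X w a : 0 <= a -> wide w X -> wide (w + 2 * a) (minkowski_sum X (disk0 a)).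
Proof.
move=> a0 wX u u1; have [x [y [Xx Xy H]]] := wX u u1.
have sa c : sq (c *: u) = c ^+ 2.
  by rewrite -[RHS]mulr1 -u1 /sq/dot/= /GRing.scale/=; ring.
exists (x + a *: u), (y + (- a) *: u); split.
- by exists x => //; exists (a *: u) => //; rewrite /disk0/= sa.
- by exists y => //; exists (- a *: u) => //; rewrite /disk0/= sa sqrrN.
have -> : dot u (x + a *: u - (y + - a *: u)) = dot u (x - y) + 2 * a * sq u.
  by rewrite /sq/dot/= /GRing.scale/=; ring.
by rewrite u1 mulr1 lerD2r.
Qed.

(** The radius is increased from [0] to [s] in [n + 1] equal steps. Before step [i] the
width is at least [d + 2 i s / (n + 1)], and [rarea_minkowski_sum_ball] gives a Riemann
sum for the integral of [pi (d + 2 r)]. *)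
Lemma rarea_parallel_body K d s : body K -> wide d K -> 0 <= d -> 0 <= s ->
  rarea K + pi * (d * s + s ^+ 2) <= rarea (minkowski_sum K (disk0 s)).
Proof.
move=> bK wK d0 s0.
suff H (n : nat) : rarea K + pi * (d * s + s ^+ 2) - (pi * s ^+ 2) / n.+1%:R <=
    rarea (minkowski_sum K (disk0 s)).
  exact: le_of_harmonic H.
pose e := s / n.+1%:R.
have nR : 0 < n.+1%:R :> R by rewrite ltr0n.
have e0 : 0 <= e by rewrite divr_ge0// ltW.
have bM i : body (minkowski_sum K (disk0 (e * i%:R))).
  by apply: body_minkowski_sum => //; apply: body_disk0; rewrite mulr_ge0.
(* e^2 (i^2 - i) is the sum of the terms 2 e^2 j for j < i *)
have step i : rarea K + pi * (e * i%:R * d + e ^+ 2 * (i%:R ^+ 2 - i%:R)) <=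
    rarea (minkowski_sum K (disk0 (e * i%:R))).
  elim: i => [|i IH].
    rewrite expr0n/= !mulr0 mul0r subr0 mulr0 addr0 mulr0 addr0.
    apply: rarea_le; [by case: bK|by have := bM 0%N; rewrite mulr0 => -[]|exact: sub_minkowski_sum_ball].
  have ei0 : 0 <= e * i%:R by rewrite mulr_ge0.
  have := rarea_minkowski_sum_ball (bM i) (wide_minkowski_sum_ball ei0 wK) e0.
  move=> /(_ (addr_ge0 d0 (mulr_ge0 (ler0n _ 2) ei0))) H.
  have : rarea (minkowski_sum (minkowski_sum K (disk0 (e * i%:R))) (disk0 e)) <=
      rarea (minkowski_sum K (disk0 (e * i.+1%:R))).
    apply: rarea_le; [|by case: (bM i.+1)|].
      by have [] := body_minkowski_sum (bM i) (body_disk0 e0).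
    by rewrite -[i.+1%:R]natr1 mulrDr mulr1; exact: minkowski_sum_ballD.
  apply: le_trans; apply: le_trans H; rewrite -[i.+1%:R]natr1.
  apply: le_trans (_ : _ <= rarea K + pi * (e * i%:R * d + e ^+ 2 * (i%:R ^+ 2 - i%:R)) +
    pi * e * (d + 2 * (e * i%:R))) _; last by rewrite lerD2r.
  by lra.
have := step n.+1; have -> : e * n.+1%:R = s by rewrite /e divfK// gt_eqF.
apply: le_trans; rewrite -addrA lerD2l.
suff : e ^+ 2 * (n.+1%:R ^+ 2 - n.+1%:R) = s ^+ 2 - s ^+ 2 / n.+1%:R.
  by move=> ->; rewrite le_eqVlt; apply/orP; left; apply/eqP; ring.
by rewrite /e; field; rewrite gt_eqF.
Qed.

(** The second condition bounds the width by [d] in every direction, and the third one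
says that this value is attained. *)
Definition constant_width d K := [/\ body K,
  forall x y, K x -> K y -> sq (x - y) <= d ^+ 2 &
  forall u, sq u = 1 -> exists2 x, K x & K (x - d *: u)].

(** The width of [X] is at most [w] in every direction. *)
Definition narrow w X := forall u, sq u = 1 -> forall x y, X x -> X y -> dot u (x - y) <= w.

Lemma narrow_diam w X : 0 <= w -> (forall x y, X x -> X y -> sq (x - y) <= w ^+ 2) -> narrow w X.
Proof.
move=> w0 H u u1 x y Xx Xy; apply: le_trans (dot_le _ _) _.
by rewrite u1 sqrtr1 mul1r -(ger0_norm w0) -sqrtr_sqr ler_wsqrtr// H.
Qed.

Lemma constant_width_wide d K : constant_width d K -> wide d K.
Proof.
move=> [_ _ H] u u1; have [x Kx Kx'] := H u u1; exists x, (x - d *: u); split=> //.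
have -> : dot u (x - (x - d *: u)) = d * sq u by rewrite /sq/dot/= /GRing.scale/=; ring.
by rewrite u1 mulr1.
Qed.

Lemma narrow_minkowski_sum_segment w l v X : narrow w X -> sq v = 1 -> 0 <= l ->
  narrow (w + 2 * l) (minkowski_sum X (segment (l *: v))).
Proof.
move=> nX v1 l0 u u1 _ _ [x Xx [_ [s + <-] ->]] [y Xy [_ [r + <-] ->]].
rewrite /= !in_itv/= => s1 r1.
have -> : dot u (x + s *: (l *: v) - (y + r *: (l *: v))) = dot u (x - y) + l * ((s - r) * dot u v).
  by rewrite /dot/= /GRing.scale/=; ring.
have := nX u u1 _ _ Xx Xy.
have : `|dot u v| <= 1.
  rewrite ler_norml; have := dot_le u v; have := dot_le (- u) v.
  have -> : dot (- u) v = - dot u v by rewrite /dot/=; ring.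
  have -> : sq (- u) = sq u by rewrite /sq/dot/=; ring.
  by rewrite u1 v1 sqrtr1 mulr1; lra.
rewrite ler_norml => uv H.
have : (s - r) * dot u v <= 2 by nra.
by move=> /(ler_wpM2l l0); lra.
Qed.

Lemma rarea_narrow_segment X u l w : body X -> narrow w X -> sq u = 1 -> 0 <= l ->
  rarea (minkowski_sum X (segment (l *: u))) <= rarea X + 2 * l * w.
Proof.
move=> bX nX u1 l0; apply: rarea_minkowski_sum_segment_le => // x y Xx Xy.
by apply: nX => //; rewrite sq_perp.
Qed.

Lemma support_function K : body K -> exists h : R * R -> R,
  (forall u x, K x -> dot u x <= h u) /\ (forall u, exists2 x, K x & h u = dot u x).
Proof.
move=> [K0 cK _].
have H u : exists x, K x /\ forall y, K y -> dot u y <= dot u x.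
  have [|x Kx Hx] := @compact_EVT_max _ _ (dot u) K K0 cK.
    apply: continuous_subspaceT => x; rewrite /dot.
    by apply: cvgD; apply: cvgM; try exact: cvg_cst; [exact: cvg_fst|exact: cvg_snd].
  by exists x; split=> [|y Ky]; [rewrite inE in Kx|apply: Hx; rewrite inE].
have [f Hf] := choice H.
exists (fun u => dot u (f u)); split=> [u x Kx|u]; first exact: (Hf u).2.
by exists (f u) => //; exact: (Hf u).1.
Qed.

(** A support function is Lipschitz, with the largest norm of a point of [K] as constant. *)
Lemma support_continuous K (h : R * R -> R) : body K ->
  (forall u x, K x -> dot u x <= h u) -> (forall u, exists2 x, K x & h u = dot u x) ->
  continuous h.
Proof.
move=> [K0 cK _] h1 h2.
have [m _ mP] := @compact_EVT_max _ _ (@sq R) K K0 cK (continuous_subspaceT (@continuous_sq R)).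
set M := Num.sqrt (sq m).
have dotB u v x : dot u x - dot v x = dot (u - v) x by rewrite /dot/=; ring.
have KM u x : K x -> dot u x <= Num.sqrt (sq u) * M.
  move=> Kx; apply: le_trans (dot_le u x) _; rewrite ler_wpM2l ?sqrtr_ge0//.
  by rewrite ler_wsqrtr// mP// inE.
have hB u v : h u - h v <= Num.sqrt (sq (u - v)) * M.
  have [x Kx ->] := h2 u; apply: le_trans (KM _ _ Kx).
  by rewrite -dotB lerD2l lerN2 h1.
move=> v; apply/cvgrPdist_le => e e0.
have gc : {for v, continuous (fun u => Num.sqrt (sq (u - v)) * M)}.
  apply: cvgM; last exact: cvg_cst.
  apply: (continuous_comp (f := fun u => sq (u - v))); last exact: sqrt_continuous.
  apply: (continuous_comp (f := fun u => u - v)); last exact: continuous_sq.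
  by apply: cvgB; [exact: cvg_id|exact: cvg_cst].
move/cvgrPdist_le : gc => /(_ e e0).
have -> : Num.sqrt (sq (v - v)) * M = 0.
  by rewrite subrr /sq/dot/= !mulr0 addr0 sqrtr0 mul0r.
apply: filterS => u; rewrite sub0r normrN ger0_norm ?mulr_ge0 ?sqrtr_ge0// => H.
have E : sq (v - u) = sq (u - v) by rewrite /sq/dot/=; ring.
by have := hB u v; have := hB v u; rewrite E ler_norml; lra.
Qed.

Definition rot60 : R * R -> R * R := rotation (1 / 2) (Num.sqrt 3 / 2).
Definition rot120 : R * R -> R * R := rotation (- 1 / 2) (Num.sqrt 3 / 2).

Lemma sqrt3 : Num.sqrt 3 ^+ 2 = 3 :> R.
Proof. by rewrite sqr_sqrtr. Qed.

Lemma sq_rotation p q u : p ^+ 2 + q ^+ 2 = 1 -> sq (rotation p q u) = sq u.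
Proof. by move=> pq; rewrite -[RHS]mul1r -pq /sq/dot/rotation/=; ring. Qed.

Lemma pq60 : (1 / 2) ^+ 2 + (Num.sqrt 3 / 2) ^+ 2 = 1 :> R.
Proof. by rewrite [(Num.sqrt 3 / 2) ^+ 2]expr_div_n sqrt3; field. Qed.

Lemma pq120 : (- 1 / 2) ^+ 2 + (Num.sqrt 3 / 2) ^+ 2 = 1 :> R.
Proof. by rewrite [(Num.sqrt 3 / 2) ^+ 2]expr_div_n sqrt3; field. Qed.

Lemma rot60E u : rot60 u = u + rot120 u.
Proof. by rewrite /rot60/rot120/rotation; congr pair => /=; field. Qed.

Lemma dotBr u v z : dot u (v - z) = dot u v - dot u z.
Proof. by rewrite /dot/=; ring. Qed.

Lemma dotDl u v z : dot (u + v) z = dot u z + dot v z.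
Proof. by rewrite /dot/=; ring. Qed.

(** Let [h] be the support function of [K]. The three strips with normals [u], [rot60 u] and
[rot120 u] that support [K] have width [d]. They cut out a regular hexagon iff their
middle lines are concurrent, which means that [phi] vanishes. As [h (- u) = d - h u],
a half-turn of [u] changes the sign of [phi], and the intermediate value theorem
applies. The point [o] is the center of the hexagon. *)
Lemma circumscribed_hexagon d K : 0 <= d -> constant_width d K -> exists u o, sq u = 1 /\
  forall x, K x -> [/\ `|dot u (x - o)| <= d / 2, `|dot (rot60 u) (x - o)| <= d / 2
    & `|dot (rot120 u) (x - o)| <= d / 2].
Proof.
move=> d0 cw; have [bK dK oK] := cw.
have [h [h1 h2]] := support_function bK.
have hc := support_continuous bK h1 h2.
have hN u : sq u = 1 -> h (- u) = d - h u.
  move=> u1; have [x Kx Kx'] := oK u u1.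
  have nK := narrow_diam d0 dK u1.
  have xB y : K y -> dot u y <= dot u x.
    move=> Ky; have := nK _ _ Ky Kx'.
    have -> : dot u (y - (x - d *: u)) = dot u y - dot u x + d * sq u.
      by rewrite /sq/dot/= /GRing.scale/=; ring.
    by rewrite u1; lra.
  have -> : h u = dot u x.
    by have [y Ky hy] := h2 u; apply/eqP; rewrite eq_le h1// andbT hy xB.
  have dN y : dot (- u) y = - dot u y by rewrite /dot/=; ring.
  have E : dot u (x - d *: u) = dot u x - d.
    have -> : dot u (x - d *: u) = dot u x - d * sq u by rewrite /sq/dot/= /GRing.scale/=; ring.
    by rewrite u1 mulr1.
  have := h1 (- u) _ Kx'; rewrite dN E.
  have [y Ky ->] := h2 (- u); have := nK _ _ Kx Ky; rewrite dN.
  have -> : dot u (x - y) = dot u x - dot u y by rewrite /dot/=; ring.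
  by move=> ? ?; apply/eqP; rewrite eq_le; apply/andP; split; lra.
pose phi a := h (dir a) - h (rot60 (dir a)) + h (rot120 (dir a)) - d / 2.
have phic : continuous phi.
  have dc : continuous (@dir R).
    move=> a; apply: (cvg_pair (G := nbhs _) (H := nbhs _)); [exact: continuous_cos|exact: continuous_sin].
  have rc p q : continuous (fun a => h (rotation p q (dir a))).
    move=> a; apply: (continuous_comp (f := fun a => rotation p q (dir a))); last exact: hc.
    by apply: continuous_comp; [exact: dc|exact: continuous_rotation].
  move=> a; rewrite /phi; apply: cvgB; last exact: cvg_cst.
  apply: cvgD; last exact: rc.
  by apply: cvgB; last exact: rc; apply: continuous_comp; [exact: dc|exact: hc].
have rN p q u : rotation p q (- u) = - rotation p q u by rewrite /rotation; congr pair => /=; ring.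
have dpi : dir pi = - dir 0 :> R * R.
  by rewrite /dir cospi sinpi cos0 sin0; congr pair; rewrite /= ?oppr0.
have phipi : phi pi = - phi 0.
  rewrite /phi dpi /rot60 /rot120 !rN !hN ?sq_rotation ?sq_dir ?pq60 ?pq120//.
  by lra.
have [a _ phia] : exists2 a, a \in `[0, pi] & phi a = 0.
  apply: IVT; first exact: pi_ge0.
    by apply: continuous_subspaceT.
  by rewrite phipi; case: (leP (phi 0) (- phi 0)) => ?; apply/andP; split; lra.
set u := dir a in phia.
exists u.
have u1 : sq u = 1 by exact: sq_dir.
have s3 := sqrt3.
pose v : R * R := rotation 0 1 u.
pose b := h u - d / 2; pose c := h (rot120 u) - d / 2.
(* the center is b u + e v: e solves - b / 2 + (sqrt 3 / 2) e = c *)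
pose e := (c + b / 2) * 2 / Num.sqrt 3.
have r30 : Num.sqrt 3 != 0 :> R by rewrite gt_eqF// sqrtr_gt0.
exists (b *: u + e *: v); split=> // x Kx.
have eE : Num.sqrt 3 * e = 2 * c + b.
  by rewrite /e; field.
have o1 : dot u (b *: u + e *: v) = b.
  have -> : dot u (b *: u + e *: v) = b * sq u by rewrite /sq/dot/v/rotation/= /GRing.scale/=; ring.
  by rewrite u1 mulr1.
have o2 : dot (rot120 u) (b *: u + e *: v) = c.
  have -> : dot (rot120 u) (b *: u + e *: v) = (- b / 2 + (Num.sqrt 3 * e) / 2) * sq u.
    by rewrite /sq/dot/v/rot120/rotation/= /GRing.scale/=; field.
  by rewrite u1 mulr1 eE; field.
have o3 : dot (rot60 u) (b *: u + e *: v) = h (rot60 u) - d / 2.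
  have -> : dot (rot60 u) (b *: u + e *: v) = b + c.
    by rewrite rot60E dotDl o1 o2.
  by move: phia; rewrite /phi /b /c -/u; lra.
have bd y : sq y = 1 -> h y - d <= dot y x <= h y.
  move=> y1; rewrite h1// andbT.
  have := h1 (- y) _ Kx; rewrite hN//.
  have -> : dot (- y) x = - dot y x by rewrite /dot/=; ring.
  by lra.
have [b1 b2 b3] : [/\ h u - d <= dot u x <= h u,
    h (rot60 u) - d <= dot (rot60 u) x <= h (rot60 u) &
    h (rot120 u) - d <= dot (rot120 u) x <= h (rot120 u)].
  by split; apply: bd; rewrite /rot60/rot120 ?sq_rotation ?pq60 ?pq120.
by rewrite !dotBr o1 o2 o3 !ler_norml; split; rewrite /b/c; lra.
Qed.

Lemma rot120_independent u z : sq u = 1 -> dot u z = 0 -> dot (rot120 u) z = 0 -> z = 0.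
Proof.
move=> u1 z1; have r30 : Num.sqrt 3 != 0 :> R by rewrite gt_eqF// sqrtr_gt0.
have -> : dot (rot120 u) z = - (1 / 2) * dot u z + Num.sqrt 3 / 2 * (u.1 * z.2 - u.2 * z.1).
  by rewrite /dot/rot120/rotation/=; field.
rewrite z1 mulr0 add0r => /eqP; rewrite mulf_eq0 mulf_eq0 (negbTE r30) invr_eq0 pnatr_eq0/=.
move=> /eqP z2; rewrite [z]surjective_pairing.
have -> : z.1 = 0.
  transitivity (u.1 * dot u z - u.2 * (u.1 * z.2 - u.2 * z.1)).
    by rewrite -[LHS]mul1r -u1 /sq/dot; ring.
  by rewrite z1 z2 !mulr0 subr0.
have -> // : z.2 = 0.
transitivity (u.2 * dot u z + u.1 * (u.1 * z.2 - u.2 * z.1)).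
  by rewrite -[LHS]mul1r -u1 /sq/dot; ring.
by rewrite z1 z2 !mulr0 addr0.
Qed.

(** A regular hexagon of width [d] is the sum of the three segments parallel to its sides,
of half-length [d / (2 sqrt 3)]. In the coordinates [a] and [c], which are scaled to
[a'] and [c'], the coefficient [r] of the middle direction has to lie in three
intervals. They intersect pairwise by the three hypotheses, so they have a common
point. *)
Lemma hexagon_zonogon d u z : 0 < d -> sq u = 1 ->
  `|dot u z| <= d / 2 -> `|dot (rot60 u) z| <= d / 2 -> `|dot (rot120 u) z| <= d / 2 ->
  exists s0 s1 s2, [/\ -1 <= s0 <= 1, -1 <= s1 <= 1, -1 <= s2 <= 1 &
    z = (d / (2 * Num.sqrt 3)) *: (s0 *: perp u + s1 *: perp (rot60 u) + s2 *: perp (rot120 u))].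
Proof.
move=> d0 u1; have -> : dot (rot60 u) z = dot u z + dot (rot120 u) z.
  by rewrite rot60E /dot/=; ring.
set a := dot u z; set c := dot (rot120 u) z; rewrite !ler_norml => Ha Hb Hc.
pose a' := 4 * a / d; pose c' := 4 * c / d.
have aE : a = a' * d / 4 by rewrite /a'; field; rewrite gt_eqF.
have cE : c = c' * d / 4 by rewrite /c'; field; rewrite gt_eqF.
have [Ha' Hb' Hc'] : [/\ -2 <= a' <= 2, -2 <= a' + c' <= 2 & -2 <= c' <= 2].
  by move: Ha Hb Hc; rewrite aE cE; split; nra.
pose r := Num.max (-1) (Num.max (a' - 1) (- c' - 1)).
have Hr : [/\ -1 <= r <= 1, -1 <= a' - r <= 1 & -1 <= c' + r <= 1].
  by rewrite /r; case: (leP (a' - 1) (- c' - 1)) => ?;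
    [case: (leP (-1) (- c' - 1))|case: (leP (-1) (a' - 1))] => ?; split; lra.
have [r1 r2 r3] := Hr.
have r30 : Num.sqrt 3 != 0 :> R by rewrite gt_eqF// sqrtr_gt0.
exists (- (c' + r)), r, (a' - r); split=> //; first by lra.
pose e := d / (2 * Num.sqrt 3); rewrite -/e.
have es : e * (Num.sqrt 3 / 2) = d / 4 by rewrite /e; field.
have dp p q p' q' : dot (rotation p q u) (perp (rotation p' q' u)) = p * q' - q * p'.
  by rewrite -[RHS]mulr1 -u1 /sq/dot/perp/rotation/=; ring.
have u0 : u = rotation 1 0 u by rewrite /rotation !mul1r !mul0r subr0 add0r -surjective_pairing.
have d00 : dot u (perp u) = 0 by rewrite /dot/perp/=; ring.
have d01 : dot u (perp (rot60 u)) = Num.sqrt 3 / 2 by rewrite {1}u0 dp; field.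
have d02 : dot u (perp (rot120 u)) = Num.sqrt 3 / 2 by rewrite {1}u0 dp; field.
have d20 : dot (rot120 u) (perp u) = - (Num.sqrt 3 / 2) by rewrite [in perp u]u0 dp; field.
have d21 : dot (rot120 u) (perp (rot60 u)) = - (Num.sqrt 3 / 2) by rewrite dp; field.
have d22 : dot (rot120 u) (perp (rot120 u)) = 0 by rewrite dp; field.
apply/eqP; rewrite -subr_eq0; apply/eqP; apply: (rot120_independent u1).
  rewrite dotBr -/a dotZr !dotDr !dotZr d00 d01 d02.
  rewrite aE; transitivity (a' * d / 4 - a' * (e * (Num.sqrt 3 / 2))); first by field.
  by rewrite es; field.
rewrite dotBr -/c dotZr !dotDr !dotZr d20 d21 d22.
rewrite cE; transitivity (c' * d / 4 - c' * (e * (Num.sqrt 3 / 2))); first by field.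
by rewrite es; field.
Qed.

Definition dilate c X : set (R * R) := [set c *: x | x in X].

Lemma scalerKV c x : c != 0 -> c *: (c^-1 *: x) = x.
Proof.
move=> c0; rewrite [RHS]surjective_pairing; congr pair; rewrite /= /GRing.scale/=; field; exact: c0.
Qed.

Lemma body_dilate c X : body X -> body (dilate c X).
Proof.
move=> [[x Xx] cX vX]; split.
- by exists (c *: x); exists x.
- apply: continuous_compact cX; apply: continuous_subspaceT => z.
  exact: scaler_continuous.
- move=> _ _ t [y Xy <-] [z Xz <-] t01; exists ((1 - t) *: y + t *: z); first exact: vX.
  by congr pair; rewrite /= /GRing.scale/=; ring.
Qed.

Lemma rarea_dilate c X : 0 < c -> compact X -> rarea (dilate c X) = c ^+ 2 * rarea X.
Proof.
move=> c0 cX; have mX := compact_measurable_plane cX.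
have c0' : c != 0 by rewrite gt_eqF.
have E : dilate c X = (fun x => c^-1 *: x) @^-1` X.
  apply/seteqP; split=> [_ [x Xx <-]|x /= Xx].
    by have := scalerKV x (invr_neq0 c0'); rewrite invrK /= => ->.
  by exists (c^-1 *: x) => //; exact: scalerKV.
have ci : 0 < c^-1 by rewrite invr_gt0.
have := area_scale ci mX; rewrite -E rareaE// => H.
have : area (dilate c X) = (c ^+ 2 * rarea X)%:E.
  rewrite EFinM H muleA -EFinM -exprMn mulfV// expr1n mul1e //.
by rewrite /rarea => ->.
Qed.

Lemma wide_dilate c w X : 0 <= c -> wide w X -> wide (c * w) (dilate c X).
Proof.
move=> c0 wX u u1; have [x [y [Xx Xy H]]] := wX u u1.
exists (c *: x), (c *: y); split; [by exists x|by exists y|].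
have -> : dot u (c *: x - c *: y) = c * dot u (x - y).
  by rewrite /dot/= /GRing.scale/=; ring.
exact: ler_wpM2l.
Qed.

Lemma rarea_translate v X : compact X -> rarea ((fun x => x + v) @^-1` X) = rarea X.
Proof. by move=> /compact_measurable_plane mX; rewrite /rarea area_translate. Qed.

Lemma compact_translate v X : compact X -> compact ((fun x => x + v) @^-1` X).
Proof.
move=> cX; rewrite (_ : _ @^-1` _ = [set x - v | x in X]); last first.
  apply/seteqP; split=> [x /= Xx|_ [x Xx <-]]; last by rewrite /= subrK.
  by exists (x + v) => //; rewrite addrK.
apply: continuous_compact cX; apply: continuous_subspaceT => z.
by apply: cvgB; [exact: cvg_id|exact: cvg_cst].
Qed.

Lemma sqZ c u : sq (c *: u) = c ^+ 2 * sq u.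
Proof. by rewrite /sq/dot/= /GRing.scale/=; ring. Qed.

(** A vector of length [r] and direction [u] is a part of the difference [d u] of two
points of [K], hence a difference of two points of the segment between them. *)
Lemma ball_sub_difference d K z : 0 < d -> constant_width d K -> sq z <= d ^+ 2 ->
  exists x y, [/\ K x, K y & z = x - y].
Proof.
move=> d0 [[[x0 Kx0] _ vK] _ oK] Hb.
have [z0|z0] := eqVneq (sq z) 0.
  exists x0, x0; split=> //; rewrite subrr [z]surjective_pairing.
  move: z0; rewrite /sq/dot -!expr2 => /eqP.
  by rewrite paddr_eq0 ?sqr_ge0// !sqrf_eq0 => /andP[/eqP-> /eqP->].
set r := Num.sqrt (sq z).
have r0 : 0 < r by rewrite sqrtr_gt0 lt_neqAle eq_sym z0 sq_ge0.
have rd : r <= d by rewrite -(ger0_norm (ltW d0)) -sqrtr_sqr ler_wsqrtr.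
have r0' : r != 0 by rewrite gt_eqF.
have d0' : d != 0 by rewrite gt_eqF.
have [|x Kx Kx'] := oK (r^-1 *: z).
  by rewrite sqZ -[sq z]sqr_sqrtr ?sq_ge0// -exprMn mulVf// expr1n.
exists x, ((1 - r / d) *: x + (r / d) *: (x - d *: (r^-1 *: z))); split=> //.
  apply: vK => //; apply/andP; split; first by rewrite divr_ge0// ltW.
  by rewrite ler_pdivrMr// mul1r.
rewrite [LHS]surjective_pairing; congr pair; rewrite /= /GRing.scale/=; field;
by rewrite r0' d0'.
Qed.

(** Chakerian's argument: [(1 - t) K + t d B] lies in a translate of [K + t H], where [H]
is the circumscribed regular hexagon. The inequality [main] compares the areas, and
dividing by [t] and letting [t] tend to [0] gives the result. *)
Lemma blaschke_lebesgue d K : 0 < d -> constant_width d K ->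
  (pi - Num.sqrt 3) * d ^+ 2 / 2 <= rarea K.
Proof.
move=> d0 cw; have [bK dK oK] := cw; have [_ cK vK] := bK.
have s3 := sqrt3; have r30 : 0 < Num.sqrt 3 :> R by rewrite sqrtr_gt0.
have r30' : Num.sqrt 3 != 0 :> R by rewrite gt_eqF.
have [u [ o [u1 Ho]]] := circumscribed_hexagon (ltW d0) cw.
pose e := d / (2 * Num.sqrt 3).
have e0 : 0 < e by rewrite divr_gt0// mulr_gt0.
have ed : 6 * e * d = Num.sqrt 3 * d ^+ 2.
  apply: (mulIf r30'); transitivity (3 * d ^+ 2); first by rewrite /e; field.
  by rewrite mulrAC -expr2 s3.
have [n60 n120] : sq (rot60 u) = 1 /\ sq (rot120 u) = 1.
  by rewrite /rot60/rot120 !sq_rotation ?pq60 ?pq120.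
have main t : 0 < t < 1 -> (1 - t) ^+ 2 * rarea K + pi * (t * d) * ((1 - t) * d) <=
    rarea K + t * (Num.sqrt 3 * d ^+ 2) + 12 * (t * e) ^+ 2.
  move=> t01; have [t0 t1] := andP t01.
  have t1' : 0 < 1 - t by lra.
  have bD := body_dilate (1 - t) bK.
  have td0 : 0 <= t * d by rewrite mulr_ge0// ltW.
  have te0 : 0 <= t * e by rewrite mulr_ge0// ltW.
  have wD := wide_dilate (ltW t1') (constant_width_wide cw).
  have := rarea_minkowski_sum_ball bD wD td0 (mulr_ge0 (ltW t1') (ltW d0)).
  rewrite rarea_dilate// => /le_trans; apply.
  pose S1 := minkowski_sum K (segment ((t * e) *: perp u)).
  pose S2 := minkowski_sum S1 (segment ((t * e) *: perp (rot60 u))).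
  pose S3 := minkowski_sum S2 (segment ((t * e) *: perp (rot120 u))).
  have [p0 p1 p2] : [/\ sq (perp u) = 1, sq (perp (rot60 u)) = 1 & sq (perp (rot120 u)) = 1].
    by rewrite !sq_perp.
  have nK := narrow_diam (ltW d0) dK.
  have n1 := narrow_minkowski_sum_segment nK p0 te0.
  have n2 := narrow_minkowski_sum_segment n1 p1 te0.
  have b1 := body_minkowski_sum bK (body_segment ((t * e) *: perp u)).
  have b2 := body_minkowski_sum b1 (body_segment ((t * e) *: perp (rot60 u))).
  have b3 := body_minkowski_sum b2 (body_segment ((t * e) *: perp (rot120 u))).
  have h1 := rarea_narrow_segment bK nK p0 te0.
  have h2 := rarea_narrow_segment b1 n1 p1 te0.
  have h3 := rarea_narrow_segment b2 n2 p2 te0.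
  have c3 : compact S3 by case: b3.
  apply: (@le_trans _ _ (rarea ((fun x => x + t *: o) @^-1` S3))); last first.
    rewrite rarea_translate// -ed; move: h1 h2 h3; rewrite -/S1 -/S2 -/S3.
    by move: (rarea K) (rarea S1) (rarea S2) (rarea S3) => k k1 k2 k3; lra.
  apply: rarea_le.
  - by have [] := body_minkowski_sum bD (body_disk0 td0).
  - exact: compact_translate.
  - move=> _ [_ [x Kx <-] [b Bb ->]].
    have t0' : t != 0 by rewrite gt_eqF.
    have [|y [y' [Ky Ky' bE]]] := @ball_sub_difference d K (t^-1 *: b) d0 cw.
      move: Bb; rewrite /disk0/= sqZ exprMn exprVn => Bb.
      by rewrite ler_pdivrMl ?exprn_gt0.
    have {}bE : b = t *: (y - y') by rewrite -bE scalerKV.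
    have [H1 H2 H3] := Ho _ Ky'.
    have oN v : `|dot v (o - y')| = `|dot v (y' - o)|.
      by rewrite -normrN; congr (`|_|); rewrite /dot/=; ring.
    rewrite -!oN in H1 H2 H3.
    have [s0 [s1 [s2 [i0 i1 i2 E]]]] := hexagon_zonogon d0 u1 H1 H2 H3.
    rewrite -/e in E.
    exists ((1 - t) *: x + t *: y + s0 *: ((t * e) *: perp u) + s1 *: ((t * e) *: perp (rot60 u))).
      exists ((1 - t) *: x + t *: y + s0 *: ((t * e) *: perp u)).
        exists ((1 - t) *: x + t *: y); first by apply: vK => //; rewrite !ltW.
        by exists (s0 *: ((t * e) *: perp u)) => //; exists s0 => //=; rewrite in_itv.
      by exists (s1 *: ((t * e) *: perp (rot60 u))) => //; exists s1 => //=; rewrite in_itv.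
    exists (s2 *: ((t * e) *: perp (rot120 u))); first by exists s2 => //=; rewrite in_itv.
    transitivity ((1 - t) *: x + t *: y + t *: (o - y')).
      by rewrite bE; congr pair; rewrite /= /GRing.scale/=; ring.
    by rewrite E; congr pair; rewrite /= /GRing.scale/=; ring.
suff H (n : nat) : (pi - Num.sqrt 3) * d ^+ 2 / 2 - (12 * e ^+ 2 + pi * d ^+ 2) / 4 / n.+1%:R <= rarea K.
  exact: le_of_harmonic H.
have nR : 0 < n.+1%:R :> R by rewrite ltr0n.
have n1 : 1 <= n.+1%:R :> R by rewrite ler1n.
pose t : R := (2 * n.+1%:R)^-1.
have t0 : 0 < t by rewrite invr_gt0 mulr_gt0.
have t12 : t <= 1 / 2 by rewrite /t mul1r lef_pV2 ?posrE ?mulr_gt0//; lra.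
have t01 : 0 < t < 1 by rewrite t0/=; lra.
have -> : (12 * e ^+ 2 + pi * d ^+ 2) / 4 / n.+1%:R = (12 * e ^+ 2 + pi * d ^+ 2) * t / 2.
  by rewrite /t; field; rewrite gt_eqF.
have A0 : 0 <= t ^+ 2 * rarea K.
  by rewrite mulr_ge0 ?sqr_ge0// /rarea fine_ge0//; case/andP: (area_fin cK).
by have := main t t01 => H; rewrite -(ler_pM2l t0); lra.
Qed.

End ConstantWidth.

(** * Completion of a set to constant width *)

Section Completion.
Variable R : realType.
Implicit Types (X Y K C : set (R * R)) (x y z u v o p : R * R) (a b c t w l h d s : R).

(** Zorn's lemma, applied to the sets whose union with [C] has diameter at most [d]. *)
Lemma diametric_completion d C : (forall x y, C x -> C y -> sq (x - y) <= d ^+ 2) ->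
  exists K, [/\ C `<=` K, forall x y, K x -> K y -> sq (x - y) <= d ^+ 2 &
    forall y, (forall x, K x -> sq (x - y) <= d ^+ 2) -> K y].
Proof.
move=> dC; have sqC x y : sq (x - y) = sq (y - x) by rewrite /sq/dot/=; ring.
pose P A := forall x y, (A `|` C) x -> (A `|` C) y -> sq (x - y) <= d ^+ 2.
have [F FP Ftot|A [PA Amax]] := @Zorn_bigcup _ P.
  move=> x y [[X FX Xx]|Cx] [[Y FY Yy]|Cy].
  - have [XY|YX] := Ftot _ _ FX FY.
      by apply: (FP _ FY); left=> //; exact: XY.
    by apply: (FP _ FX); left=> //; exact: YX.
  - by apply: (FP _ FX); [left|right].
  - by apply: (FP _ FY); [right|left].
  - exact: dC.
exists (A `|` C); split=> // y Hy.
apply: contrapT => nAy; apply: (Amax (A `|` [set y])).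
  split; first by left.
  by move=> H; apply: nAy; left; apply: H; right.
have yy : sq (y - y) <= d ^+ 2 by rewrite subrr /sq/dot/= !mulr0 addr0 sqr_ge0.
move=> x z [[Ax|->]|Cx] [[Az|->]|Cz] //.
- by apply: PA; left.
- by apply: Hy; left.
- by apply: PA; [left|right].
- by rewrite sqC; apply: Hy; left.
- by rewrite sqC; apply: Hy; right.
- by apply: PA; [right|left].
- by apply: Hy; right.
- exact: dC.
Qed.

Lemma sq_conv x y t : sq ((1 - t) *: x + t *: y) =
  (1 - t) * sq x + t * sq y - t * (1 - t) * sq (x - y).
Proof. by rewrite /sq/dot/= /GRing.scale/=; ring. Qed.

Lemma continuous_dot u : continuous (dot u).
Proof.
move=> x; rewrite /dot.
by apply: cvgD; apply: cvgM; try exact: cvg_cst; [exact: cvg_fst|exact: cvg_snd].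
Qed.

Lemma closed_sq_ball x a : closed [set y | sq (x - y) <= a].
Proof.
apply: (@closed_comp _ _ (fun y => sq (x - y)) [set r | r <= a]); last exact: closed_le.
move=> y _; apply: (continuous_comp (f := fun u => x - u)); last exact: continuous_sq.
by apply: cvgB; [exact: cvg_cst|exact: cvg_id].
Qed.

Lemma compact_sq_ball x a : 0 <= a -> compact [set y | sq (x - y) <= a ^+ 2].
Proof.
move=> a0; have [_ cB _] := body_disk0 a0.
have := compact_translate (v := - x) cB; congr compact; apply/seteqP; split=> y /=;
  by rewrite /disk0/= (_ : sq (y - x) = sq (x - y))//; rewrite /sq/dot/=; ring.
Qed.

(** Completeness says that [K] is the intersection of the disks of radius [d] around its
points. If [x] is a point of [K] extremal in the direction [u], then [x - d u] is within
[d] of all of [K], and belongs to [K] for this reason. *)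
Lemma complete_constant_width d K : 0 < d -> K !=set0 ->
  (forall x y, K x -> K y -> sq (x - y) <= d ^+ 2) ->
  (forall y, (forall x, K x -> sq (x - y) <= d ^+ 2) -> K y) -> constant_width d K.
Proof.
move=> d0 [x0 Kx0] dK cplK.
have cK : compact K.
  apply: (@subclosed_compact _ _ [set y | sq (x0 - y) <= d ^+ 2]).
  - rewrite (_ : K = \bigcap_(x in K) [set y | sq (x - y) <= d ^+ 2]).
      by apply: closed_bigI => x _; exact: closed_sq_ball.
    apply/seteqP; split=> [y Ky x Kx|y Hy]; first exact: dK.
    by apply: cplK => x Kx; exact: Hy.
  - exact/compact_sq_ball/ltW.
  - by move=> y Ky; exact: dK.
have vK : cvx K.
  move=> x y t Kx Ky t01; apply: cplK => z Kz.
  have -> : z - ((1 - t) *: x + t *: y) = (1 - t) *: (z - x) + t *: (z - y).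
    by congr pair; rewrite /= /GRing.scale/=; ring.
  have [_ _ vB] := body_disk0 (ltW d0).
  by apply: vB => //; exact: dK.
split=> //; first by split=> //; exists x0.
move=> u u1.
have [|x] := @compact_EVT_max _ _ (dot u) K _ cK (continuous_subspaceT (@continuous_dot u)).
  by exists x0.
rewrite inE => Kx xmax; exists x => //; apply: (cplK _) => y Ky.
rewrite leNgt; apply/negP => yx.
set m := sq (x - y); set a := dot u (x - y).
have a0 : 0 <= a by rewrite /a dotBr subr_ge0 xmax// inE.
have am : 2 * d * a < m.
  move: yx; have -> : sq (y - (x - d *: u)) = m - 2 * d * a + d ^+ 2 * sq u.
    by rewrite /m /a /sq/dot/= /GRing.scale/=; ring.
  by rewrite u1; lra.
(* The point x + e (y - x) + (e b) u is higher than x in the direction u because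
   a < b, and for a small e > 0 it stays in all disks of radius d that contain x
   and y because b < m / (2 d). This contradicts the maximality of x. *)
pose b := (a + m / (2 * d)) / 2.
have bm : 2 * d * b = (2 * d * a + m) / 2 by rewrite /b; field; rewrite gt_eqF.
have ab : a < b by rewrite -(ltr_pM2l d0); lra.
have b0 : 0 < b by lra.
pose g := m - 2 * d * b.
have g0 : 0 < g by rewrite /g bm; lra.
have m0 : 0 < m by rewrite (le_lt_trans _ am)// !mulr_ge0// ltW.
have M0 : 0 < m + b ^+ 2 by rewrite addr_gt0// exprn_gt0.
pose e := g / (m + b ^+ 2).
have e0 : 0 < e by exact: divr_gt0.
have e1 : e <= 1.
  rewrite /e ler_pdivrMr// mul1r /g.
  have := mulr_ge0 (mulr_ge0 (ler0n R 2) (ltW d0)) (ltW b0).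
  by have := sqr_ge0 b; lra.
have e1' : 0 <= 1 - e by lra.
have eg : e * (m + b ^+ 2) = g by rewrite /e divfK// gt_eqF.
have Kz : K ((1 - e) *: x + e *: y + (e * b) *: u).
  apply: cplK => z Kz.
  set q := (1 - e) *: (z - x) + e *: (z - y).
  have -> : z - ((1 - e) *: x + e *: y + (e * b) *: u) = q + (- (e * b)) *: u.
    by congr pair; rewrite /= /GRing.scale/=; ring.
  have qle : sq q <= d ^+ 2 - e * (1 - e) * m.
    rewrite sq_conv; have -> : sq (z - x - (z - y)) = m by rewrite /m/sq/dot/=; ring.
    have := ler_wpM2l e1' (dK _ _ Kz Kx); have := ler_wpM2l (ltW e0) (dK _ _ Kz Ky).
    by lra.
  have qd : dot (- u) q <= d.
    apply: le_trans (dot_le _ _) _.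
    have -> : sq (- u) = 1 by rewrite -u1 /sq/dot/=; ring.
    rewrite sqrtr1 mul1r -(ger0_norm (ltW d0)) -sqrtr_sqr ler_wsqrtr//.
    apply: le_trans qle _; have := mulr_ge0 (mulr_ge0 (ltW e0) e1') (ltW m0).
    by lra.
  have -> : sq (q + - (e * b) *: u) = sq q + 2 * (e * b) * dot (- u) q + (e * b) ^+ 2 * sq u.
    by rewrite /sq/dot/= /GRing.scale/=; ring.
  rewrite u1 mulr1.
  have eb0 := mulr_ge0 (ler0n R 2) (mulr_ge0 (ltW e0) (ltW b0)).
  have := ler_wpM2l eb0 qd.
  have : e * (e * (m + b ^+ 2)) = e * (m - 2 * d * b) by rewrite eg.
  by lra.
have := xmax _ (mem_set Kz).
have -> : dot u ((1 - e) *: x + e *: y + (e * b) *: u) = dot u x - e * a + e * b * sq u.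
  by rewrite /a /sq/dot/= /GRing.scale/=; ring.
rewrite u1 mulr1; have : e * a < e * b by rewrite ltr_pM2l.
by lra.
Qed.

End Completion.

(** * The area of a disk-polygon *)

Section Strictness.
Variable R : realType.
Implicit Types (X Y K C D : set (R * R)) (x y z u v o p : R * R) (a b c t w l h d s : R).

Lemma diskE a x y : 0 <= a -> disk a x y <-> sq (x - y) <= a ^+ 2.
Proof.
move=> a0; have E : Defs.edist x y = Num.sqrt (sq (x - y)).
  by rewrite /Defs.edist /sq/dot/=; congr Num.sqrt; ring.
rewrite /disk /mkset E; split=> [H|H].
  by rewrite -[sq _]sqr_sqrtr ?sq_ge0// ler_pXn2r// nnegrE ?sqrtr_ge0.
by rewrite -(ger0_norm a0) -sqrtr_sqr ler_wsqrtr.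
Qed.

Lemma diskB a x : 0 <= a -> disk a x = [set y | sq (x - y) <= a ^+ 2].
Proof. by move=> a0; apply/seteqP; split=> y /diskE => /(_ a0). Qed.

Lemma open_area_gt0 U : open U -> U !=set0 -> (0 < @area R U)%E.
Proof.
move=> oU [x Ux].
have /nbhs_ballP[e /= e0 beU] : nbhs x U by rewrite openE in oU; exact: oU.
apply: (@lt_le_trans _ _ (area (`[x.1, x.1 + e / 2]%classic `*` `[x.2, x.2 + e / 2]%classic))).
  rewrite /area product_measure1E; [|exact: measurable_itv|exact: measurable_itv].
  have E r : lebesgue_measure `[r, r + e / 2]%classic = (e / 2)%:E.
    by rewrite lebesgue_measure_segment ?lerDl ?divr_ge0 ?ltW// addrAC subrr add0r.
  have := E x.1; have := E x.2 => E1 E2.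
  change (0 < lebesgue_measure `[x.1, (x.1 + e / 2)%R]%classic *
    lebesgue_measure `[x.2, (x.2 + e / 2)%R]%classic)%E.
  by rewrite E1 E2 -EFinM lte_fin mulr_gt0// divr_gt0.
apply: le_measure; rewrite ?inE.
- by apply: measurableX; exact: measurable_itv.
- exact: open_measurable_plane.
move=> y [] /=; rewrite !in_itv/= => y1 y2; apply: beU.
by split; rewrite /ball/= ltr_norml; lra.
Qed.

(** This is the equality case of [|p + s u| <= d + s]. *)
Lemma tangent_point p u d s : 0 < s -> sq u = 1 -> sq p <= d ^+ 2 -> 0 <= d ->
  d ^+ 2 + 2 * d * s + s ^+ 2 <= sq (p + s *: u) -> p = d *: u.
Proof.
move=> s0 u1 pd d0.
have -> : sq (p + s *: u) = sq p + 2 * s * dot p u + s ^+ 2 * sq u.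
  by rewrite /sq/dot/= /GRing.scale/=; ring.
rewrite u1 => H.
have Hd : d <= dot p u by rewrite -(ler_pM2l s0); lra.
have : sq (p - d *: u) <= 0.
  have -> : sq (p - d *: u) = sq p - 2 * d * dot p u + d ^+ 2 * sq u.
    by rewrite /sq/dot/= /GRing.scale/=; ring.
  by rewrite u1; have := ler_wpM2l d0 Hd; lra.
move=> H2; have : sq (p - d *: u) == 0 by rewrite eq_le H2 sq_ge0.
rewrite {1}/sq/dot -!expr2 paddr_eq0 ?sqr_ge0// !sqrf_eq0 => /andP[/eqP E1 /eqP E2].
apply/eqP; rewrite -subr_eq0; apply/eqP.
by rewrite [LHS]surjective_pairing E1 E2.
Qed.

Lemma dir_inj a b : `|a - b| <= 1 -> dir a = dir b -> a = b.
Proof.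
move=> ab [ca sa].
have s0 : sin (a - b) = 0 by rewrite sinB ca sa; ring.
apply/eqP; rewrite -subr_eq0; apply/negPn/negP => n0.
have pi2 := pi_ge2 R.
move: ab; rewrite ler_norml => ab.
have [ab0|ab0] := ltP 0 (a - b).
  have : 0 < sin (a - b) by apply: sin_gt0_pi; rewrite ab0/=; lra.
  by rewrite s0 ltxx.
have ab0' : a - b < 0 by rewrite lt_neqAle n0.
have : 0 < sin (- (a - b)) by apply: sin_gt0_pi; apply/andP; split; lra.
by rewrite sinN s0 oppr0 ltxx.
Qed.

(** Points of a short arc determine their parameter, so a finite set containing the arc
would make an interval finite. *)
Lemma finite_set_misses_arc C p d a b : finite_set C -> 0 < d -> a < b ->
  exists2 t, a <= t <= b & ~ C (p + d *: dir t).
Proof.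
move=> fC d0 ab; apply: contrapT => H.
pose b' := Num.min b (a + 1).
have ab' : a < b' by rewrite /b'; case: (leP b (a + 1)) => ?; lra.
have bb : b' <= b by rewrite /b'; case: (leP b (a + 1)) => ?; lra.
have ba : b' <= a + 1 by rewrite /b'; case: (leP b (a + 1)) => ?; lra.
have inC t : a <= t <= b' -> C (p + d *: dir t).
  move=> tab; apply: contrapT => nC; apply: H; exists t => //.
  by lra.
have : finite_set `[a, b']%classic.
  have inv z : exists t, forall r, a <= r <= b' -> p + d *: dir r = z -> r = t.
    have [[t tab <-]|nt] := pselect (exists2 t, a <= t <= b' & p + d *: dir t = z); last first.
      by exists 0 => r rab E; case: nt; exists r.
    exists t => r rab /addrI E; apply: dir_inj; first by rewrite ler_norml; lra.
    have d0' : d != 0 by rewrite gt_eqF.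
    have := scalerKV (dir r) (invr_neq0 d0'); rewrite invrK E => <-.
    by have := scalerKV (dir t) (invr_neq0 d0'); rewrite invrK => ->.
  have [g gP] := choice inv.
  apply: (sub_finite_set _ (finite_image g fC)) => t; rewrite /= in_itv/= => tab.
  by exists (p + d *: dir t); [exact: inC|apply/esym; exact: gP].
move=> /finite_set_countable/countable_lebesgue_measure0.
rewrite lebesgue_measure_segment ?ltW// => -[].
by apply/eqP; rewrite subr_eq0 gt_eqF.
Qed.

Lemma edist_sq a x y : 0 <= a -> Defs.edist x y <= a <-> sq (x - y) <= a ^+ 2.
Proof. exact: diskE. Qed.

(** The homothety of center [z] and ratio [t] maps the ball around [v] into [D]. *)
Lemma cvx_ball_interior D z v e t : cvx D -> D z -> ball v e `<=` D -> 0 < e ->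
  0 < t <= 1 -> D° ((1 - t) *: z + t *: v).
Proof.
move=> vD Dz veD e0 t01; have t0 : 0 < t by case/andP: t01.
apply/nbhs_ballP; exists (t * e); first exact: mulr_gt0.
move=> y [y1 y2].
have -> : y = (1 - t) *: z + t *: (v + t^-1 *: (y - ((1 - t) *: z + t *: v))).
  by rewrite [LHS]surjective_pairing; congr pair; rewrite /= /GRing.scale/=; field; rewrite gt_eqF.
apply: vD => //; last by lra.
apply: veD; move: y1 y2; rewrite /ball/= => y1 y2.
split; rewrite /ball/= /GRing.scale/=.
  rewrite (_ : _ - _ = t^-1 * ((1 - t) * z.1 + t * v.1 - y.1)); last by ring.
  by rewrite normrM gtr0_norm ?invr_gt0// ltr_pdivrMl.
rewrite (_ : _ - _ = t^-1 * ((1 - t) * z.2 + t * v.2 - y.2)); last by ring.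
by rewrite normrM gtr0_norm ?invr_gt0// ltr_pdivrMl.
Qed.

Lemma areaU X Y : measurable X -> measurable Y -> X `&` Y = set0 ->
  area (X `|` Y) = (area X + area Y)%E.
Proof. by move=> mX mY XY; rewrite /area measureU. Qed.

(** A point slightly moved from [z] towards the interior of [D] is interior to [D] and
still outside the closed set [X], so an open set of positive area separates the two. *)
Lemma area_lt_of_missed_point X D z : compact X -> measurable D -> cvx D -> D° !=set0 ->
  X `<=` D -> D z -> ~ X z -> ((rarea X)%:E < area D)%E.
Proof.
move=> cX mD vD [v /nbhs_ballP[e /= e0 veD]] XD Dz nXz.
have clX := compact_closed (@norm_hausdorff _ _) cX.
pose U := D° `&` ~` X.
have oU : open U by apply: openI; [exact: open_interior|exact: closed_openC].
have U0 : U !=set0.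
  have : (fun t : R => (1 - t) *: z + t *: v) @ 0^'+ --> z.
    rewrite -[X in _ --> X](_ : (1 - 0) *: z + 0 *: v = z); last first.
      by rewrite [RHS]surjective_pairing; congr pair; rewrite /= /GRing.scale/=; ring.
    apply: cvg_at_right_filter; apply: cvgD.
      apply: (continuous_comp (f := fun t : R => 1 - t) (g := fun s : R => s *: z)).
        by apply: cvgB; [exact: cvg_cst|exact: cvg_id].
      exact: scalel_continuous.
    exact: scalel_continuous.
  move=> /(_ (~` X)); have nX : nbhs z (~` X).
    by apply: open_nbhs_nbhs; split=> //; exact: closed_openC.
  move=> /(_ nX) H.
  near (0 : R)^'+ => t.
  exists ((1 - t) *: z + t *: v); split; last first.
    by near: t; exact: H.
  apply: (cvx_ball_interior vD Dz veD e0); apply/andP; split => //.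
  by near: t; apply: nbhs_right_le; exact: ltr01.
have aU := open_area_gt0 oU U0.
have mX := compact_measurable_plane cX.
have mU := open_measurable_plane oU.
apply: (@lt_le_trans _ _ (area (X `|` U))); last first.
  apply: le_measure; rewrite ?inE//; first exact: measurableU.
  by move=> x [/XD//|[/interior_subset]].
rewrite areaU//; last by apply/seteqP; split=> // x [Xx []].
by rewrite rareaE// lteDl.
Unshelve. all: by end_near.
Qed.

(** The set [X] is the outer parallel domain of the completion [K] of the centers. It lies
in [D], and the point [z] of [D] outside [X] makes the inequality strict. *)
Lemma area_disk_polygon_gt d D : 0 < d < 1 -> disk_polygons_with_center_parameter d D ->
  ((pi * (1 - d) + (pi - Num.sqrt 3) * d ^+ 2 / 2)%:E < area D)%E.
Proof.
move=> /andP[d0 d1] [C [fC C0 DE D0 arcC] dC].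
have dC' x y : C x -> C y -> sq (x - y) <= d ^+ 2.
  by move=> Cx Cy; apply/edist_sq; [exact: ltW|exact: dC].
have [K [CK dK cplK]] := diametric_completion dC'.
have K0 : K !=set0 by case: C0 => x /CK; exists x.
have cw := complete_constant_width d0 K0 dK cplK.
have [bK _ _] := cw.
pose s := 1 - d; have s0 : 0 < s by rewrite /s; lra.
have ds : d + s = 1 by rewrite /s; lra.
set X := minkowski_sum K (disk0 s).
have [_ cX vX] : body X by apply: body_minkowski_sum => //; apply: body_disk0; exact: ltW.
have XP x y : X x -> K y -> sq (y - x) <= 1.
  move=> [z Kz [b Bb ->]] Ky.
  have -> : y - (z + b) = (y - z) + (- b) by rewrite opprD addrA.
  rewrite -(expr1n _ 2) -ds; apply: sqD_le; [exact: ltW|exact: ltW|exact: dK|].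
  by rewrite (_ : sq (- b) = sq b)//; rewrite /sq/dot/=; ring.
have DP x : D x <-> forall y, C y -> sq (y - x) <= 1.
  rewrite DE; split=> H c Cc; have := H c Cc.
    by move=> /(diskE _ _ ler01); rewrite expr1n.
  by move=> ?; apply/(diskE _ _ ler01); rewrite expr1n.
have XD : X `<=` D by move=> x Xx; apply/DP => c /CK; exact: XP.
have clD : closed D.
  rewrite DE; apply: closed_bigI => c _; rewrite diskB//; exact: closed_sq_ball.
have vD : cvx D.
  move=> x y t /DP Dx /DP Dy t01; apply/DP => c Cc.
  have -> : c - ((1 - t) *: x + t *: y) = (1 - t) *: (c - x) + t *: (c - y).
    by congr pair; rewrite /= /GRing.scale/=; ring.
  rewrite sq_conv; have [t0 t1] := andP t01; have t1' : 0 <= 1 - t by lra.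
  have := ler_wpM2l t1' (Dx _ Cc); have := ler_wpM2l t0 (Dy _ Cc).
  have := mulr_ge0 (mulr_ge0 t0 t1') (sq_ge0 (c - x - (c - y))).
  by lra.
have [z Dz nXz] : exists2 z, D z & ~ X z.
  have [c Cc] := C0; have [a [b [ab arcD]]] := arcC _ Cc.
  have Ddir t : a <= t <= b -> D (c + dir t).
    move=> tab; have [] // : boundary D (c + dir t).
      apply: arcD; exists t; rewrite /= ?in_itv//=.
      by congr pair; rewrite /dir/= mul1r.
    by move=> /clD.
  have [[t tab nX]|allX] := pselect (exists2 t, a <= t <= b & ~ X (c + dir t)).
    by exists (c + dir t) => //; exact: Ddir.
  have inX t : a <= t <= b -> X (c + dir t).
    by move=> tab; apply: contrapT => nX; apply: allX; exists t.
  have [t tab nCt] := finite_set_misses_arc c fC d0 ab.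
  set u := dir t in nCt; have u1 : sq u = 1 by exact: sq_dir.
  have Kp : K (c + d *: u).
    have [x Kx [v Bv xv]] := inX t tab.
    suff <- : x = c + d *: u by [].
    apply/eqP; rewrite -subr_eq0 opprD addrA subr_eq0; apply/eqP.
    (* |u| = 1 = d + s forces x - c and v to be parallel to u *)
    have xc : sq (x - c) <= d ^+ 2 by apply: dK => //; exact: CK.
    have E : u = (x - c) + v by rewrite /u -[dir t](addKr c) xv; congr pair; rewrite /=; ring.
    have xu : dot u (x - c) <= d.
      apply: le_trans (dot_le _ _) _; rewrite u1 sqrtr1 mul1r.
      by rewrite -(ger0_norm (ltW d0)) -sqrtr_sqr ler_wsqrtr.
    have vu : dot u v <= s.
      apply: le_trans (dot_le _ _) _; rewrite u1 sqrtr1 mul1r.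
      by rewrite -(ger0_norm (ltW s0)) -sqrtr_sqr ler_wsqrtr.
    have uu : dot u (x - c) + dot u v = 1 by rewrite -dotDr -E.
    apply: (tangent_point s0 u1 xc (ltW d0)).
    have -> : sq (x - c + s *: u) = sq (x - c) + 2 * s * dot u (x - c) + s ^+ 2 * sq u.
      by rewrite /sq/dot/= /GRing.scale/=; ring.
    rewrite u1 mulr1 lerD2r.
    have du : dot u (x - c) = d by lra.
    rewrite du; have : d <= Num.sqrt (sq (x - c)).
      by rewrite -{1}du; have := dot_le u (x - c); rewrite u1 sqrtr1 mul1r.
    move=> H; have : d ^+ 2 <= sq (x - c).
      by rewrite -[leRHS]sqr_sqrtr ?sq_ge0// ler_pXn2r// nnegrE ?sqrtr_ge0// ltW.
    by lra.
  (* the point c - s u is strictly inside all the disks *)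
  have lt1 (c' : R * R) : C c' -> sq (c' - c + s *: u) < 1.
    move=> Cc'; rewrite ltNge; apply/negP => H; apply: nCt.
    have E : c' - c = d *: u.
      apply: (tangent_point s0 u1 (dC' _ _ Cc' Cc) (ltW d0)).
      have -> : d ^+ 2 + 2 * d * s + s ^+ 2 = (d + s) ^+ 2 by ring.
      by rewrite ds expr1n.
    by rewrite -E addrC subrK.
  have [c' c'C c'max] : exists2 y, C y & forall x, C x ->
      sq (x - c + s *: u) <= sq (y - c + s *: u).
    have [|c'] := @compact_EVT_max _ _ (fun x => sq (x - c + s *: u)) C C0 (finite_compact fC).
      apply: continuous_subspaceT => x.
      apply: (continuous_comp (f := fun x => x - c + s *: u)); last exact: continuous_sq.
      by apply: cvgD; [apply: cvgB; [exact: cvg_id|exact: cvg_cst]|exact: cvg_cst].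
    rewrite inE => c'C H; exists c' => // y Cy; apply: H; exact: mem_set.
  pose m := Num.sqrt (sq (c' - c + s *: u)).
  have m1 : m < 1 by rewrite -sqrtr1 ltr_sqrt ?ltr01// lt1.
  have m0 : 0 <= m by exact: sqrtr_ge0.
  exists (c - (1 - m + s) *: u).
    apply/DP => y Cy.
    have -> : y - (c - (1 - m + s) *: u) = (y - c + s *: u) + (1 - m) *: u.
      by congr pair; rewrite /= /GRing.scale/=; ring.
    apply: (@le_trans _ _ ((m + (1 - m)) ^+ 2)); last first.
      by rewrite (_ : m + (1 - m) = 1) ?expr1n//; ring.
    apply: sqD_le => //; first by lra.
      by rewrite sqr_sqrtr ?sq_ge0//; exact: c'max.
    by rewrite sqZ u1 mulr1.
  move=> /XP /(_ Kp).
  have -> : c + d *: u - (c - (1 - m + s) *: u) = (d + s + (1 - m)) *: u.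
    by congr pair; rewrite /= /GRing.scale/=; ring.
  by rewrite sqZ u1 mulr1 ds leNgt => /negP; apply; nra.
apply: le_lt_trans (area_lt_of_missed_point cX (closed_measurable_plane clD) vD D0 XD Dz nXz).
rewrite lee_fin.
have := rarea_parallel_body bK (constant_width_wide cw) (ltW d0) (ltW s0).
have := blaschke_lebesgue d0 cw; rewrite -/X /s.
set A := rarea K; set A' := rarea X => H1 H2.
apply: le_trans H2; apply: le_trans (lerD H1 (lexx _)).
lra.
Qed.

End Strictness.

(** * The area of a circular sector *)

Section Sector.
Variable R : realType.
Local Notation mu := (@lebesgue_measure R).
Implicit Types (X Y : set (R * R)) (x y z u v o p q : R * R) (a b : R * R) (c d r s t : R).

(** The triple-angle formula at [pi / 3] reads [(c + 1) (2 c - 1)^2 = 0]. *)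
Lemma cos_pi3 : cos (pi / 3) = 1 / 2 :> R.
Proof.
have pi0 := pi_gt0 R.
set c := cos (pi / 3).
have c0 : 0 < c by apply: cos_gt0_pihalf; lra.
have s2 : sin (pi / 3) ^+ 2 = 1 - c ^+ 2.
  by have := cos2Dsin2 (pi / 3 : R); rewrite -/c; lra.
have : cos pi = 4 * c ^+ 3 - 3 * c :> R.
  have -> : pi = pi / 3 + (pi / 3 + pi / 3) :> R by field.
  rewrite cosD [cos (_ + _)]cosD [sin (_ + _)]sinD -/c.
  transitivity (c ^+ 3 - 3 * c * sin (pi / 3) ^+ 2); first by ring.
  by rewrite s2; ring.
rewrite cospi => H.
have : (c + 1) * (2 * c - 1) ^+ 2 = 0.
  transitivity (4 * c ^+ 3 - 3 * c + 1); first by ring.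
  by rewrite -H; ring.
move=> /eqP; rewrite mulf_eq0 gt_eqF ?addr_gt0//= sqrf_eq0 => /eqP; lra.
Qed.

Lemma asin_sqrt3_half : asin (Num.sqrt 3 / 2) = pi / 3 :> R.
Proof.
have pi0 := pi_gt0 R.
have s0 : 0 <= sin (pi / 3) :> R by apply: sin_ge0_pi; lra.
have -> : Num.sqrt 3 / 2 = sin (pi / 3) :> R.
  have E : (Num.sqrt 3 / 2) ^+ 2 = sin (pi / 3) ^+ 2 :> R.
    have := cos2Dsin2 (pi / 3 : R); have := pq60 R; rewrite cos_pi3; lra.
  apply/eqP; rewrite -(eqrXn2 (n := 2)) ?E//.
by rewrite sinK// in_itv/=; lra.
Qed.

(** The area between the circle and the line [x = sqrt 3 y] over the interval from [0] to
[r]. *)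
Definition sector_primitive (r : R) :=
  (asin r + r * Num.sqrt (1 - r ^+ 2)) / 2 - r ^+ 2 / (2 * Num.sqrt 3).

Lemma is_derive_sector_primitive r : -1 < r < 1 ->
  is_derive r 1 sector_primitive (Num.sqrt (1 - r ^+ 2) - r / Num.sqrt 3).
Proof.
move=> r1.
have q0 : 0 < 1 - r ^+ 2 by nra.
have s0 : Num.sqrt (1 - r ^+ 2) != 0 by rewrite gt_eqF// sqrtr_gt0.
have s30 : Num.sqrt 3 != 0 :> R by rewrite gt_eqF// sqrtr_gt0.
have d1 := is_derive1_asin r1.
have d2 : is_derive r 1 (fun r : R => Num.sqrt (1 - r ^+ 2))
    ((2 * Num.sqrt (1 - r ^+ 2))^-1 * (- (2 * r))).
  apply: (@is_derive1_comp _ Num.sqrt (fun r : R => 1 - r ^+ 2)).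
    exact: is_derive1_sqrt.
  by apply: is_derive_eq; rewrite /GRing.scale/=; ring.
rewrite /sector_primitive; apply: is_derive_eq.
set w := Num.sqrt _ in s0 *.
have w2 : w ^+ 2 = 1 - r ^+ 2 by rewrite sqr_sqrtr// ltW.
rewrite /GRing.scale/=.
transitivity ((1 - r ^+ 2) / w / 2 + w / 2 - r / Num.sqrt 3).
  by field; rewrite s0 s30.
by rewrite -w2; field; rewrite s0 s30.
Qed.

(** The sector of the unit disk between the second axis and the direction at angle [pi / 3]
from it. *)
Definition std_sector : set (R * R) :=
  [set x | [/\ 0 <= x.1, x.1 <= Num.sqrt 3 * x.2 & sq x <= 1]].

Lemma compact_std_sector : compact std_sector.
Proof.
have [_ cB _] := @body_disk0 R 1 ler01.
apply: subclosed_compact cB _; last by move=> x [_ _]; rewrite /disk0/= expr1n.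
have -> : std_sector = [set x | 0 <= dot (1, 0) x] `&`
    ([set x | 0 <= dot (-1, Num.sqrt 3) x] `&` [set x | sq x <= 1]).
  apply/seteqP; rewrite /std_sector /dot/=.
  split=> x /=; rewrite mul1r mul0r addr0 mulN1r addrC subr_ge0; first by case.
  by move=> [? [? ?]].
have cl u : closed [set x | 0 <= dot u x].
  apply: (@closed_comp _ _ (dot u) [set r | 0 <= r]); last exact: closed_ge.
  by move=> x _; exact: continuous_dot.
apply: closedI => //; apply: closedI => //.
apply: (@closed_comp _ _ (@sq R) [set r | r <= 1]); last exact: closed_le.
by move=> x _; exact: continuous_sq.
Qed.

Lemma rarea_std_sector : rarea std_sector = pi / 6.
Proof.
have s3 := sqrt3 R.
have s30 : 0 < Num.sqrt 3 :> R by rewrite sqrtr_gt0.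
have s30' : Num.sqrt 3 != 0 :> R by rewrite gt_eqF.
have s32 : Num.sqrt 3 / 2 < 1 :> R by nra.
pose f (r : R) := Num.sqrt (1 - r ^+ 2) - r / Num.sqrt 3.
have secE r : mu (xsection std_sector r) = ((fun r => (f r)%:E) \_ `[0%R, (Num.sqrt 3 / 2)%R]) r.
  rewrite patchE; case: ifPn; rewrite ?notin_setE ?inE /= in_itv/= => Hr.
    have [r0 r1] := andP Hr.
    have r2 : r ^+ 2 <= 3 / 4.
      have : r ^+ 2 <= (Num.sqrt 3 / 2) ^+ 2 by rewrite ler_pXn2r ?nnegrE// divr_ge0// ltW.
      by rewrite expr_div_n s3; lra.
    have rs0 : 0 <= r / Num.sqrt 3 by rewrite divr_ge0// ltW.
    rewrite (_ : xsection std_sector r = `[r / Num.sqrt 3, Num.sqrt (1 - r ^+ 2)]%classic).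
      apply: lebesgue_measure_segment.
      rewrite -[leLHS]ger0_norm// -sqrtr_sqr ler_wsqrtr//.
      by rewrite expr_div_n s3; lra.
    apply/seteqP; split=> y; rewrite /xsection/= inE /std_sector/sq/dot/= in_itv/= ler_pdivrMr//.
      rewrite [y * Num.sqrt _]mulrC => -[_ -> H]/=.
      apply: le_trans (ler_norm y) _; rewrite -sqrtr_sqr ler_wsqrtr//.
      by rewrite expr2; lra.
    rewrite [y * Num.sqrt _]mulrC => /andP[H1 H2]; split=> //.
    have y0 : 0 <= y by rewrite -(ler_pM2l s30) mulr0 (le_trans r0).
    have : y ^+ 2 <= Num.sqrt (1 - r ^+ 2) ^+ 2 by rewrite ler_pXn2r// nnegrE sqrtr_ge0.
    by rewrite sqr_sqrtr; lra.
  rewrite (_ : xsection std_sector r = set0) ?measure0//.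
  apply/seteqP; split=> // y; rewrite /xsection/= inE => -[/= r0 ry ryo]; apply: Hr.
  rewrite r0/=; move: ryo; rewrite /sq/dot/= => ryo.
  have : r ^+ 2 <= (Num.sqrt 3 * y) ^+ 2 by rewrite ler_pXn2r ?nnegrE// (le_trans r0).
  rewrite exprMn s3 => H.
  have : r ^+ 2 <= (Num.sqrt 3 / 2) ^+ 2 by rewrite expr_div_n s3; lra.
  by rewrite ler_pXn2r// nnegrE divr_ge0// ltW.
have -> : rarea std_sector = fine (\int[mu]_(r in `[0%R, (Num.sqrt 3 / 2)%R]) (f r)%:E).
  rewrite /rarea /area /product_measure1 [in RHS]integral_mkcond; congr fine.
  by apply: eq_integral => r _; exact: secE.
have in1 (r : R) : 0 <= r <= Num.sqrt 3 / 2 -> -1 < r < 1 by lra.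
have cF (r : R) : 0 <= r <= Num.sqrt 3 / 2 -> {for r, continuous sector_primitive}.
  move=> /in1 /is_derive_sector_primitive H.
  by apply/differentiable_continuous/derivable1_diffP; exact: ex_derive.
have s3h : 0 < Num.sqrt 3 / 2 :> R by rewrite divr_gt0.
rewrite (@continuous_FTC2 _ f sector_primitive) //.
- have asin0 : asin 0 = 0 :> R.
    by rewrite -[X in asin X]sin0 sinK// in_itv/=; have := pi_gt0 R; lra.
  rewrite -EFinB /= /sector_primitive asin_sqrt3_half asin0 expr_div_n s3.
  have -> : 1 - 3 / 2 ^+ 2 = (1 / 2) ^+ 2 :> R by field.
  rewrite sqrtr_sqr ger0_norm//.
  transitivity (pi / 6 + Num.sqrt 3 / 8 - (Num.sqrt 3 ^+ 2) / (8 * Num.sqrt 3) : R).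
    by rewrite s3; field.
  by field.
- apply: continuous_subspaceT => r; rewrite /f; apply: cvgB; last first.
    by apply: cvgM; [exact: cvg_id|exact: cvg_cst].
  apply: (continuous_comp (f := fun r : R => 1 - r ^+ 2)); last exact: sqrt_continuous.
  by apply: cvgB; [exact: cvg_cst|exact: exprn_continuous].
- split.
  + move=> r; rewrite in_itv/= => r1.
    have /is_derive_sector_primitive H : -1 < r < 1 by apply: in1; lra.
    exact: ex_derive.
  + by apply: cvg_at_right_filter; apply: cF; lra.
  + by apply: cvg_at_left_filter; apply: cF; lra.
- move=> r; rewrite in_itv/= => r1.
  have /is_derive_sector_primitive H : -1 < r < 1 by apply: in1; lra.
  by rewrite derive1E derive_val.
Qed.

Definition half_plane v o : set (R * R) := [set y | 0 <= dot v (y - o)].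

Lemma closed_half_plane v o : closed (half_plane v o).
Proof.
apply: (@closed_comp _ _ (fun y => dot v (y - o)) [set r | 0 <= r]); last exact: closed_ge.
move=> y _; apply: (continuous_comp (f := fun y => y - o)); last exact: continuous_dot.
by apply: cvgB; [exact: cvg_id|exact: cvg_cst].
Qed.

(** For vectors [a] and [b] of equal length at angle [pi / 3], this is the sector with
vertex [o] and radius [r] spanned by [a] and [b]: the vectors [2 a - b] and [2 b - a]
are normal to [b] and to [a]. *)
Definition sector o a b r : set (R * R) :=
  half_plane (2 *: a - b) o `&` half_plane (2 *: b - a) o `&` [set y | sq (o - y) <= r ^+ 2].

Lemma compact_sector o a b r : 0 <= r -> compact (sector o a b r).
Proof.
move=> r0; apply: (@subclosed_compact _ _ [set y | sq (o - y) <= r ^+ 2]).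
- apply: closedI; last exact: closed_sq_ball.
  by apply: closedI; exact: closed_half_plane.
- exact: compact_sq_ball.
- by move=> y [].
Qed.

Lemma dot_rotation u v c s : c ^+ 2 + s ^+ 2 = 1 -> dot (rotation c s u) (rotation c s v) = dot u v.
Proof. by move=> cs; rewrite -[RHS]mul1r -cs /dot/rotation/=; ring. Qed.

(** A rotation taking [a] to the second axis, a dilation and a translation identify the
sector with the standard one. Exchanging [a] and [b] does not change the sector,
so the orientation can be chosen. *)
Lemma rarea_sector o a b r d : 0 < d -> 0 < r -> sq a = d ^+ 2 -> sq b = d ^+ 2 ->
  dot a b = d ^+ 2 / 2 -> rarea (sector o a b r) = r ^+ 2 * (pi / 6).
Proof.
move=> d0 r0.
wlog det0 : a b / 0 <= a.2 * b.1 - a.1 * b.2.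
  move=> H sa sb ab; have [/H|h] := leP 0 (a.2 * b.1 - a.1 * b.2); first exact.
  rewrite (_ : sector o a b r = sector o b a r); last first.
    by rewrite /sector [X in X `&` _]setIC.
  apply: H => //; first by lra.
  by rewrite -ab /dot; ring.
move=> sa sb ab.
have d0' : d != 0 by rewrite gt_eqF.
have r0' : r != 0 by rewrite gt_eqF.
have s3 := sqrt3 R; have s30 : 0 < Num.sqrt 3 :> R by rewrite sqrtr_gt0.
set k := Num.sqrt 3 in s3 s30.
have det : a.2 * b.1 - a.1 * b.2 = k / 2 * d ^+ 2.
  have kd0 : 0 <= k / 2 * d ^+ 2 by rewrite mulr_ge0 ?sqr_ge0// divr_ge0// ltW.
  apply/eqP; rewrite -(eqrXn2 (n := 2))//.
  apply/eqP; transitivity (sq a * sq b - dot a b ^+ 2); first by rewrite /sq/dot; ring.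
  have -> : (k / 2 * d ^+ 2) ^+ 2 = k ^+ 2 * (d ^+ 2) ^+ 2 / 4 by field.
  by rewrite sa sb ab s3; field.
have pq : (a.2 / d) ^+ 2 + (a.1 / d) ^+ 2 = 1.
  transitivity (sq a / d ^+ 2); first by rewrite /sq/dot; field.
  by rewrite sa divff// expf_neq0.
pose f := rotation (a.2 / d) (a.1 / d).
have fa : f a = (0, d).
  rewrite /f/rotation; congr pair; first by field.
  transitivity (sq a / d); first by rewrite /sq/dot; field.
  by rewrite sa; field.
have fb : f b = (k / 2 * d, d / 2).
  rewrite /f/rotation; congr pair.
    transitivity ((a.2 * b.1 - a.1 * b.2) / d); first by field.
    by rewrite det; field.
  transitivity (dot a b / d); first by rewrite /dot; field.
  by rewrite ab; field.
have dotf u y : dot u y = dot (f u) (f y) by rewrite dot_rotation.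
have secE : sector o a b r = (fun y => y + (- o)) @^-1` (dilate r (f @^-1` std_sector)).
  have key x : [/\ 0 <= dot (2 *: a - b) x, 0 <= dot (2 *: b - a) x & sq x <= r ^+ 2] <->
      std_sector (f (r^-1 *: x)).
    have E1 : dot (2 *: a - b) x = 2 * dot a x - dot b x by rewrite /dot/= /GRing.scale/=; ring.
    have E2 : dot (2 *: b - a) x = 2 * dot b x - dot a x by rewrite /dot/= /GRing.scale/=; ring.
    rewrite E1 E2 !(dotf _ x) fa fb.
    have -> : sq x = r ^+ 2 * sq (f (r^-1 *: x)).
      rewrite /sq -dotf -!/(sq _) sqZ mulrA -exprMn divff// expr1n mul1r //.
    have fE : f x = r *: f (r^-1 *: x) by rewrite /f -rotationZ scalerKV.
    rewrite fE; move: (f (r^-1 *: x)) => y; rewrite /std_sector /mkset -/k.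
    have dp (c s : R) z : dot (c, s) z = c * z.1 + s * z.2 by [].
    have -> : 2 * dot (0, d) (r *: y) - dot (k / 2 * d, d / 2) (r *: y) =
       (r * d * k / 2) * (k * y.2 - y.1).
      transitivity (r * d / 2 * (k ^+ 2 * y.2 - k * y.1)); last by ring.
      by rewrite s3 !dotZr !dp; field.
    have -> : 2 * dot (k / 2 * d, d / 2) (r *: y) - dot (0, d) (r *: y) = (r * d * k) * y.1.
      by rewrite !dotZr !dp; field.
    have rd : 0 < r * d * k by rewrite !mulr_gt0.
    rewrite pmulr_rge0 ?divr_gt0// subr_ge0 pmulr_rge0// ger_pMr ?exprn_gt0//.
    by split=> -[].
  have -> : sector o a b r = [set y | [/\ 0 <= dot (2 *: a - b) (y - o),
      0 <= dot (2 *: b - a) (y - o) & sq (y - o) <= r ^+ 2]].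
    have sqC y : sq (o - y) = sq (y - o) by rewrite /sq/dot/=; ring.
    by apply/seteqP; split=> y; rewrite /sector/half_plane/= sqC; [move=> [[]]|move=> []].
  apply/seteqP; split=> y /=.
    by move/key => H; exists (r^-1 *: (y - o)) => //; exact: scalerKV.
  move=> [x fx xE]; apply/key; rewrite -xE.
  by have := scalerKV x (invr_neq0 r0'); rewrite invrK => ->.
have cS := compact_std_sector.
have fS : f @^-1` std_sector = [set rotation (a.2 / d) (- (a.1 / d)) x | x in std_sector].
  have K := rotationK pq; have pq' : (a.2 / d) ^+ 2 + (- (a.1 / d)) ^+ 2 = 1 by rewrite sqrrN.
  have K' := rotationK pq'; rewrite opprK in K'.
  apply/seteqP; split=> [x /= fx|_ [x Sx <-]]; first by exists (f x) => //; exact: K.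
  by rewrite /= /f K'.
have cf : compact (f @^-1` std_sector).
  rewrite fS; apply: continuous_compact cS; apply: continuous_subspaceT; exact: continuous_rotation.
have cd : compact (dilate r (f @^-1` std_sector)).
  apply: continuous_compact cf; apply: continuous_subspaceT => z; exact: scaler_continuous.
rewrite secE rarea_translate// rarea_dilate//; congr (_ * _).
rewrite -rarea_std_sector /rarea; congr fine.
by have [] := area_rotation pq (compact_measurable_plane cS).
Qed.

End Sector.

(** * The area of a rounded Reuleaux triangle *)

Section RoundedReuleaux.
Variable R : realType.
Implicit Types (X Y : set (R * R)) (x y z u v a b o : R * R) (d r s t : R).

Lemma dot_eq0 d a b z : 0 < d -> sq a = d ^+ 2 -> sq b = d ^+ 2 -> dot a b = d ^+ 2 / 2 ->
  dot a z = 0 -> dot b z = 0 -> z = 0.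
Proof.
move=> d0 sa sb ab az bz; set D := a.1 * b.2 - a.2 * b.1.
have D0 : D != 0.
  rewrite -sqrf_eq0 (_ : D ^+ 2 = sq a * sq b - dot a b ^+ 2); last by rewrite /D/sq/dot; ring.
  rewrite sa sb ab (_ : _ - _ = 3 / 4 * d ^+ 4); last by field.
  by rewrite mulf_neq0// ?expf_neq0 ?gt_eqF.
have z1 : D * z.1 = 0.
  transitivity (b.2 * dot a z - a.2 * dot b z); first by rewrite /D/dot; ring.
  by rewrite az bz !mulr0 subrr.
have z2 : D * z.2 = 0.
  transitivity (a.1 * dot b z - b.1 * dot a z); first by rewrite /D/dot; ring.
  by rewrite az bz !mulr0 subrr.
move/eqP: z1 z2; rewrite mulf_eq0 (negbTE D0)/= => /eqP z1 /eqP.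
rewrite mulf_eq0 (negbTE D0)/= => /eqP z2.
by rewrite [z]surjective_pairing z1 z2.
Qed.

Lemma basis_expansion d a b x : 0 < d -> sq a = d ^+ 2 -> sq b = d ^+ 2 -> dot a b = d ^+ 2 / 2 ->
  x = (2 / 3 / d ^+ 2 * (2 * dot a x - dot b x)) *: a +
      (2 / 3 / d ^+ 2 * (2 * dot b x - dot a x)) *: b.
Proof.
move=> d0 sa sb ab; have d0' : d != 0 by rewrite gt_eqF.
have ba : dot b a = d ^+ 2 / 2 by rewrite -ab /dot; ring.
apply/eqP; rewrite -subr_eq0; apply/eqP; apply: (dot_eq0 d0 sa sb ab);
  rewrite dotBr dotDr !dotZr -?/(sq _) ?sa ?sb ?ab ?ba; by field.
Qed.

(** For [a] and [b] of equal length at angle [pi / 3], this is the triangle with vertices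
[o], [o + a] and [o + b]. *)
Definition triangle o a b : set (R * R) :=
  half_plane (2 *: a - b) o `&` half_plane (2 *: b - a) o `&`
  [set y | dot (a + b) (y - o) <= 3 / 2 * sq a].

Lemma dot2B a b x : dot (2 *: a - b) x = 2 * dot a x - dot b x.
Proof. by rewrite /dot/= /GRing.scale/=; ring. Qed.

Lemma triangle_sub d o a b r : 0 < d -> d <= r -> sq a = d ^+ 2 -> sq b = d ^+ 2 ->
  dot a b = d ^+ 2 / 2 -> triangle o a b `<=` sector o a b r.
Proof.
move=> d0 dr sa sb ab y [[h1 h2] h3]; split=> //=.
move: h1 h2 h3; rewrite /half_plane/= !dot2B dotDl sa => h1 h2 h3.
apply: (@le_trans _ _ (d ^+ 2)); last by rewrite ler_pXn2r ?nnegrE// ltW// (lt_le_trans d0).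
have -> : sq (o - y) = sq (y - o) by rewrite /sq/dot/=; ring.
have := basis_expansion (y - o) d0 sa sb ab.
set al := 2 / 3 / d ^+ 2 * (2 * dot a (y - o) - _); set be := _ * (2 * dot b (y - o) - _) => ->.
have k0 : 0 <= 2 / 3 / d ^+ 2 by rewrite divr_ge0// exprn_ge0// ltW.
have al0 : 0 <= al by rewrite mulr_ge0.
have be0 : 0 <= be by rewrite mulr_ge0.
have ab1 : al + be <= 1.
  have -> : al + be = 2 / 3 / d ^+ 2 * (dot a (y - o) + dot b (y - o)).
    by rewrite /al/be; field; rewrite gt_eqF.
  apply: le_trans (ler_wpM2l k0 h3) _.
  by rewrite le_eqVlt; apply/orP; left; apply/eqP; field; rewrite gt_eqF.
have -> : sq (al *: a + be *: b) = al ^+ 2 * sq a + be ^+ 2 * sq b + 2 * al * be * dot a b.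
  by rewrite /sq/dot/= /GRing.scale/=; ring.
rewrite sa sb ab (_ : _ + _ = (al ^+ 2 + be ^+ 2 + al * be) * d ^+ 2); last by field.
by rewrite ler_piMl ?sqr_ge0//; nra.
Qed.

Lemma compact_triangle d o a b : 0 < d -> sq a = d ^+ 2 -> sq b = d ^+ 2 ->
  dot a b = d ^+ 2 / 2 -> compact (triangle o a b).
Proof.
move=> d0 sa sb ab.
apply: (@subclosed_compact _ _ (sector o a b d)).
- apply: closedI; first by apply: closedI; exact: closed_half_plane.
  apply: (@closed_comp _ _ (fun y => dot (a + b) (y - o)) [set r | r <= 3 / 2 * sq a]);
    last exact: closed_le.
  move=> y _; apply: (continuous_comp (f := fun y => y - o)); last exact: continuous_dot.
  by apply: cvgB; [exact: cvg_id|exact: cvg_cst].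
- exact/compact_sector/ltW.
- exact: (triangle_sub d0 (lexx d)).
Qed.

Lemma triangle_coord d o a b s t : sq a = d ^+ 2 -> sq b = d ^+ 2 -> dot a b = d ^+ 2 / 2 ->
  0 <= s -> 0 <= t -> s + t <= 1 -> triangle o a b (o + (s *: a + t *: b)).
Proof.
move=> sa sb ab s0 t0 st; have d2 : 0 <= d ^+ 2 by exact: sqr_ge0.
have ba : dot b a = d ^+ 2 / 2 by rewrite -ab /dot; ring.
have E : o + (s *: a + t *: b) - o = s *: a + t *: b by rewrite addrC addKr.
rewrite /triangle /half_plane /setI /mkset E !dot2B dotDl !dotDr !dotZr -!/(sq _) sa sb ab ba.
split; first split.
- rewrite (_ : _ - _ = 3 / 2 * s * d ^+ 2); last by field.
  by apply: mulr_ge0 => //; lra.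
- rewrite (_ : _ - _ = 3 / 2 * t * d ^+ 2); last by field.
  by apply: mulr_ge0 => //; lra.
- rewrite (_ : _ + _ + _ = 3 / 2 * (s + t) * d ^+ 2); last by field.
  by rewrite ler_wpM2r//; lra.
Qed.

(** The parallelogram is the sum of two segments, so its area is at least the length of one
times the width of the other across it. *)
Lemma rarea_parallelogram d a b : 0 < d -> sq a = d ^+ 2 -> sq b = d ^+ 2 ->
  dot a b = d ^+ 2 / 2 ->
  Num.sqrt 3 / 2 * d ^+ 2 <= rarea (minkowski_sum (segment ((1 / 2) *: a)) (segment ((1 / 2) *: b))).
Proof.
move=> d0 sa sb ab; have d0' : d != 0 by rewrite gt_eqF.
have -> : (1 / 2) *: b = (d / 2) *: (d^-1 *: b).
  by congr pair; rewrite /= /GRing.scale/=; field.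
have u1 : sq (d^-1 *: b) = 1 by rewrite sqZ sb exprVn mulVf// expf_neq0.
set v := (1 / 2) *: a.
have sv : segment v v by exists 1; rewrite ?scale1r//= in_itv/=; lra.
have svN : segment v (- v) by exists (-1); rewrite ?scaleN1r//= in_itv/=; lra.
set D := b.2 * a.1 - b.1 * a.2.
have E1 : dot (perp (d^-1 *: b)) (v - - v) = D / d.
  by rewrite /D/v/dot/perp/= /GRing.scale/=; field.
have E2 : dot (perp (d^-1 *: b)) (- v - v) = - D / d.
  by rewrite /D/v/dot/perp/= /GRing.scale/=; field.
have D2 : D ^+ 2 = (Num.sqrt 3 / 2 * d ^+ 2) ^+ 2.
  transitivity (sq a * sq b - dot a b ^+ 2); first by rewrite /D/sq/dot; ring.
  have -> : (Num.sqrt 3 / 2 * d ^+ 2) ^+ 2 = Num.sqrt 3 ^+ 2 * (d ^+ 2) ^+ 2 / 4 :> R by field.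
  by rewrite sa sb ab sqrt3; field.
have wv : exists x y, [/\ segment v x, segment v y &
    Num.sqrt 3 / 2 * d <= dot (perp (d^-1 *: b)) (x - y)].
  move/eqP: D2; rewrite eqf_sqr => /orP[] /eqP DE.
    by exists v, (- v); split=> //; rewrite E1 DE ler_pdivlMr// expr2 mulrA.
  by exists (- v), v; split=> //; rewrite E2 DE opprK ler_pdivlMr// expr2 mulrA.
have := rarea_minkowski_sum_segment_ge (body_segment v) u1 (divr_ge0 (ltW d0) (ler0n _ 2)) wv.
apply: le_trans; have -> : 2 * (d / 2) * (Num.sqrt 3 / 2 * d) = Num.sqrt 3 / 2 * d ^+ 2 by field.
by rewrite lerDr /rarea fine_ge0//; case/andP: (area_fin (@compact_segment _ v)).
Qed.

Lemma rarea_reflect o X : compact X ->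
  compact ((fun y => o - y) @^-1` X) /\ rarea ((fun y => o - y) @^-1` X) = rarea X.
Proof.
move=> cX; have pq : (-1) ^+ 2 + 0 ^+ 2 = 1 :> R by ring.
have cX' := compact_translate (v := o) cX.
have E : (fun y => o - y) @^-1` X = rotation (-1) 0 @^-1` ((fun y => y + o) @^-1` X).
  apply/seteqP; split=> y /=; rewrite (_ : rotation (-1) 0 y + o = o - y)//;
  by rewrite addrC; congr (_ + _); rewrite /rotation; congr pair; rewrite /=; ring.
split.
  have -> : (fun y => o - y) @^-1` X = [set o - y | y in X].
    apply/seteqP; split=> [y Xy|_ [y Xy <-]]; last by rewrite /= opprB addrC subrK.
    by exists (o - y) => //; rewrite opprB addrC subrK.
  apply: continuous_compact cX; apply: continuous_subspaceT => y.
  by apply: cvgB; [exact: cvg_cst|exact: cvg_id].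
rewrite E -(rarea_translate o cX) {1}/rarea.
by have [_ ->] := area_rotation pq (compact_measurable_plane cX').
Qed.

(** The triangle and its reflection in the midpoint of the side opposite to [o] cover the
parallelogram spanned by [a] and [b]. *)
Lemma rarea_triangle d o a b : 0 < d -> sq a = d ^+ 2 -> sq b = d ^+ 2 ->
  dot a b = d ^+ 2 / 2 -> Num.sqrt 3 / 4 * d ^+ 2 <= rarea (triangle o a b).
Proof.
move=> d0 sa sb ab.
have cT := @compact_triangle d o a b d0 sa sb ab.
have PA := rarea_parallelogram d0 sa sb ab.
have coord s t := @triangle_coord d o a b s t sa sb ab.
have [cT' aT'] := rarea_reflect (o + (o + (a + b))) cT.
move: (triangle o a b) cT coord cT' aT' => T cT coord.
set T' := _ @^-1` T => cT' aT'.
have T'P y : T (o + (o + (a + b)) - y) -> T' y by [].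
move: T' cT' aT' T'P => T' cT' aT' T'P.
have cP : compact (minkowski_sum (segment ((1 / 2) *: a)) (segment ((1 / 2) *: b))).
  by apply: compact_minkowski_sum; exact: compact_segment.
have cTT : compact (T `|` T') by exact: compactU.
pose m := o + (1 / 2) *: (a + b).
have sub : minkowski_sum (segment ((1 / 2) *: a)) (segment ((1 / 2) *: b)) `<=`
    (fun y => y + m) @^-1` (T `|` T').
  move=> _ [_ [t + <-] [_ [s + <-] ->]]; rewrite /= !in_itv/= => t1 s1.
  have [ts|ts] := leP (t + s) 0.
    left; rewrite (_ : _ + m = o + (((1 + t) / 2) *: a + ((1 + s) / 2) *: b)).
      by apply: coord; lra.
    by congr pair; rewrite /m/= /GRing.scale/=; field.
  right; apply: T'P.
  rewrite (_ : _ - _ = o + (((1 - t) / 2) *: a + ((1 - s) / 2) *: b)).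
    by apply: coord; lra.
  by congr pair; rewrite /m/= /GRing.scale/=; field.
have H := rarea_le cP (compact_translate (v := m) cTT) sub.
rewrite rarea_translate// in H.
have : rarea (T `|` T') <= rarea T + rarea T'.
  rewrite -lee_fin EFinD -!rareaE//; apply: measureU2; exact: compact_measurable_plane.
rewrite aT'; move: (rarea _) (rarea _) (rarea _) PA H => p q r; lra.
Qed.

Lemma areaD X Y : measurable X -> compact Y -> Y `<=` X ->
  area X = ((rarea Y)%:E + area (X `\` Y))%E.
Proof.
move=> mX cY YX; have mY := compact_measurable_plane cY.
rewrite -rareaE// -areaU//; last 2 first.
- exact: measurableD.
- by apply/seteqP; split=> // x [Yx []].
congr area; apply/seteqP; split=> [x Xx|x [/YX//|[]//]].
by have [Yx|nYx] := pselect (Y x); [left|right].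
Qed.

(** The vector [x] lies in the cone spanned by [- a] and [- b], which is the normal cone of
the Reuleaux triangle at its vertex [0]. So [dot y x <= 0] for every [y] in the
Reuleaux triangle, and the vertex [0] is its nearest point to [x]. *)
Lemma nearest_vertex d a b x y : 0 < d -> sq a = d ^+ 2 -> sq b = d ^+ 2 ->
  dot a b = d ^+ 2 / 2 -> sq (y - a) <= d ^+ 2 -> sq (y - b) <= d ^+ 2 ->
  2 * dot a x - dot b x <= 0 -> 2 * dot b x - dot a x <= 0 -> sq x <= sq (y - x).
Proof.
move=> d0 sa sb ab ya yb la lb.
have ya' : 0 <= dot y a.
  move: ya; have -> : sq (y - a) = sq y + sq a - 2 * dot y a by rewrite /sq/dot/=; ring.
  by have := sq_ge0 y; rewrite sa; lra.
have yb' : 0 <= dot y b.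
  move: yb; have -> : sq (y - b) = sq y + sq b - 2 * dot y b by rewrite /sq/dot/=; ring.
  by have := sq_ge0 y; rewrite sb; lra.
have -> : sq (y - x) = sq y + sq x - 2 * dot y x by rewrite /sq/dot/=; ring.
have k0 : 0 <= 2 / 3 / d ^+ 2 by rewrite divr_ge0// exprn_ge0// ltW.
have := basis_expansion x d0 sa sb ab.
set al := 2 / 3 / d ^+ 2 * (2 * dot a x - _); set be := _ * (2 * dot b x - _) => xE.
have al0 : al <= 0 by rewrite mulr_ge0_le0.
have be0 : be <= 0 by rewrite mulr_ge0_le0.
have : dot y x <= 0.
  by rewrite xE dotDr !dotZr; have := mulr_le0_ge0 al0 ya'; have := mulr_le0_ge0 be0 yb'; lra.
by have := sq_ge0 y; lra.
Qed.

(** Let [la], [lb] and [lc] be the signed distances to the three side lines of the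
triangle, up to a factor. A point of the domain is in the triangle if no sign is
negative, in a sector of radius [1] if one is, and in an opposite sector of radius [s]
by [nearest_vertex] if two are. *)
Lemma area_rounded_reuleaux d D : 0 < d < 1 -> rounded_reuleaux d D ->
  (area D <= (pi * (1 - d) + (pi - Num.sqrt 3) * d ^+ 2 / 2)%:E)%E.
Proof.
move=> /andP[d0 d1] [T [p1 [p2 [p3 [e12 e23 e31 TE]]]] DE].
pose s := 1 - d.
have total k : Num.sqrt 3 / 4 * d ^+ 2 <= k ->
    k + ((pi / 6 - k) + ((pi / 6 - k) + ((pi / 6 - k) +
      (s ^+ 2 * (pi / 6) + (s ^+ 2 * (pi / 6) + s ^+ 2 * (pi / 6)))))) <=
    pi * (1 - d) + (pi - Num.sqrt 3) * d ^+ 2 / 2.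
  by rewrite /s; lra.
have s0 : 0 < s by rewrite /s; lra.
have ds : d + s = 1 by rewrite /s; lra.
have eE x y : Defs.edist x y = d -> sq (y - x) = d ^+ 2.
  move=> <-; rewrite /Defs.edist sqr_sqrtr ?addr_ge0 ?sqr_ge0//.
  by rewrite /sq/dot/=; ring.
pose a := p2 - p1; pose b := p3 - p1.
have sa : sq a = d ^+ 2 by exact: eE.
have sb : sq b = d ^+ 2.
  by rewrite -(eE _ _ e31) /b /sq/dot/=; ring.
have ab : dot a b = d ^+ 2 / 2.
  have : sq (p3 - p2) = d ^+ 2 by exact: eE.
  have -> : sq (p3 - p2) = sq a + sq b - 2 * dot a b by rewrite /a/b/sq/dot/=; ring.
  by rewrite sa sb; lra.
have ba : dot b a = d ^+ 2 / 2 by rewrite -ab /dot; ring.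
have sc : sq (b - a) = d ^+ 2.
  have -> : sq (b - a) = sq a + sq b - 2 * dot a b by rewrite /sq/dot/=; ring.
  by rewrite sa sb ab; field.
have sN u : sq (- u) = sq u by rewrite /sq/dot/=; ring.
have dNN u v : dot (- u) (- v) = dot u v by rewrite /dot/=; ring.
have p2E : p2 = p1 + a by rewrite /a addrC subrK.
have p3E : p3 = p1 + b by rewrite /b addrC subrK.
have dac : dot (- a) (b - a) = d ^+ 2 / 2.
  have -> : dot (- a) (b - a) = sq a - dot a b by rewrite /sq/dot/=; ring.
  by rewrite sa ab; field.
have dbc : dot (- b) (a - b) = d ^+ 2 / 2.
  have -> : dot (- b) (a - b) = sq b - dot a b by rewrite /sq/dot/=; ring.
  by rewrite sb ab; field.
have scN : sq (a - b) = d ^+ 2 by rewrite -opprB sN.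
pose Tr := triangle p1 a b.
pose S1 := sector p1 a b 1.
pose S2 := sector p2 (- a) (b - a) 1.
pose S3 := sector p3 (- b) (a - b) 1.
pose N1 := sector p1 (- a) (- b) s.
pose N2 := sector p2 a (a - b) s.
pose N3 := sector p3 b (b - a) s.
(* barycentric coordinates, up to the positive factor 2 / (3 d^2) *)
pose la y := 2 * dot a (y - p1) - dot b (y - p1).
pose lb y := 2 * dot b (y - p1) - dot a (y - p1).
pose lc y := 3 / 2 * d ^+ 2 - dot a (y - p1) - dot b (y - p1).
have S1P y : S1 y <-> [/\ 0 <= la y, 0 <= lb y & sq (p1 - y) <= 1].
  rewrite /S1 /sector /half_plane/= !dot2B expr1n.
  by split=> [[[]]|[]].
have S2e y : dot (2 *: - a - (b - a)) (y - p2) = lc y.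
  have -> : lc y = sq a + dot a b - dot a (y - p1) - dot b (y - p1) by rewrite /lc sa ab; field.
  by rewrite p2E /sq/dot/= /GRing.scale/=; ring.
have S2e' y : dot (2 *: (b - a) - - a) (y - p2) = lb y.
  have -> : lb y = sq a - 2 * dot a b + 2 * dot b (y - p1) - dot a (y - p1).
    by rewrite /lb sa ab; field.
  by rewrite p2E /sq/dot/= /GRing.scale/=; ring.
have S3e y : dot (2 *: - b - (a - b)) (y - p3) = lc y.
  have -> : lc y = sq b + dot a b - dot a (y - p1) - dot b (y - p1) by rewrite /lc sb ab; field.
  by rewrite p3E /sq/dot/= /GRing.scale/=; ring.
have S3e' y : dot (2 *: (a - b) - - b) (y - p3) = la y.
  have -> : la y = sq b - 2 * dot a b + 2 * dot a (y - p1) - dot b (y - p1).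
    by rewrite /la sb ab; field.
  by rewrite p3E /sq/dot/= /GRing.scale/=; ring.
have S2P y : S2 y <-> [/\ 0 <= lc y, 0 <= lb y & sq (p2 - y) <= 1].
  rewrite /S2 /sector /half_plane/= S2e S2e' expr1n.
  by split=> [[[]]|[]].
have S3P y : S3 y <-> [/\ 0 <= lc y, 0 <= la y & sq (p3 - y) <= 1].
  rewrite /S3 /sector /half_plane/= S3e S3e' expr1n.
  by split=> [[[]]|[]].
have N1P y : N1 y <-> [/\ la y <= 0, lb y <= 0 & sq (p1 - y) <= s ^+ 2].
  rewrite /N1 /sector /half_plane/= !dot2B.
  have E u v : dot (- u) v = - dot u v by rewrite /dot/=; ring.
  rewrite !E; split=> [[[h1 h2] h3]|[h1 h2 h3]]; split=> //; rewrite ?/la ?/lb in h1 h2 *; [lra|lra|].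
  by split; lra.
have N2P y : N2 y <-> [/\ lc y <= 0, lb y <= 0 & sq (p2 - y) <= s ^+ 2].
  have E1 : dot (2 *: a - (a - b)) (y - p2) = - lc y.
    by rewrite -S2e /dot/= /GRing.scale/=; ring.
  have E2 : dot (2 *: (a - b) - a) (y - p2) = - lb y.
    by rewrite -S2e' /dot/= /GRing.scale/=; ring.
  rewrite /N2 /sector /half_plane/= E1 E2 !oppr_ge0.
  by split=> [[[]]|[]].
have N3P y : N3 y <-> [/\ lc y <= 0, la y <= 0 & sq (p3 - y) <= s ^+ 2].
  have E1 : dot (2 *: b - (b - a)) (y - p3) = - lc y.
    by rewrite -S3e /dot/= /GRing.scale/=; ring.
  have E2 : dot (2 *: (b - a) - b) (y - p3) = - la y.
    by rewrite -S3e' /dot/= /GRing.scale/=; ring.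
  rewrite /N3 /sector /half_plane/= E1 E2 !oppr_ge0.
  by split=> [[[]]|[]].
have TrP y : Tr y <-> [/\ 0 <= la y, 0 <= lb y & 0 <= lc y].
  rewrite /Tr /triangle /half_plane/= !dot2B dotDl sa.
  have -> : (dot a (y - p1) + dot b (y - p1) <= 3 / 2 * d ^+ 2) = (0 <= lc y).
    by rewrite /lc; apply/idP/idP => ?; lra.
  by split=> [[[]]|[]].
have Tr2 y : Tr y -> triangle p2 (- a) (b - a) y.
  move=> /TrP[h1 h2 h3]; rewrite /triangle /half_plane/= S2e S2e'; split=> //.
  rewrite sN sa; have -> : dot (- a + (b - a)) (y - p2) = 3 / 2 * d ^+ 2 - la y.
    have -> : 3 / 2 * d ^+ 2 = 2 * sq a - dot a b by rewrite sa ab; field.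
    by rewrite p2E /la /sq/dot/=; ring.
  by lra.
have Tr3 y : Tr y -> triangle p3 (- b) (a - b) y.
  move=> /TrP[h1 h2 h3]; rewrite /triangle /half_plane/= S3e S3e'; split=> //.
  rewrite sN sb; have -> : dot (- b + (a - b)) (y - p3) = 3 / 2 * d ^+ 2 - lb y.
    have -> : 3 / 2 * d ^+ 2 = 2 * sq b - dot a b by rewrite sb ab; field.
    by rewrite p3E /lb /sq/dot/=; ring.
  by lra.
have TS1 : Tr `<=` S1 by exact: (triangle_sub d0 (ltW d1)).
have TS2 : Tr `<=` S2.
  by move=> y /Tr2; apply: (triangle_sub d0 (ltW d1)) => //; rewrite sN.
have TS3 : Tr `<=` S3.
  by move=> y /Tr3; apply: (triangle_sub d0 (ltW d1)) => //; rewrite sN.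
have DP y : D y -> exists z, [/\ sq (p1 - z) <= d ^+ 2, sq (p2 - z) <= d ^+ 2,
    sq (p3 - z) <= d ^+ 2 & sq (z - y) <= s ^+ 2].
  rewrite DE => -[t]; rewrite TE => -[[t1 t2] t3] ty; exists t.
  by split; apply/diskE => //; exact: ltW.
have cover : D `<=` Tr `|` ((S1 `\` Tr) `|` ((S2 `\` Tr) `|` ((S3 `\` Tr) `|` (N1 `|` (N2 `|` N3))))).
  move=> y /DP[t [t1 t2 t3 ty]].
  have in1 o : sq (o - t) <= d ^+ 2 -> sq (o - y) <= 1.
    move=> ot; rewrite (_ : o - y = (o - t) + (t - y)); last by rewrite addrA subrK.
    rewrite -(expr1n _ 2) -ds; apply: sqD_le => //; exact: ltW.
  have sqC x z : sq (x - z) = sq (z - x) by rewrite /sq/dot/=; ring.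
  have near o u v : sq u = d ^+ 2 -> sq v = d ^+ 2 -> dot u v = d ^+ 2 / 2 ->
      sq (o + u - t) <= d ^+ 2 -> sq (o + v - t) <= d ^+ 2 ->
      dot (2 *: u - v) (y - o) <= 0 -> dot (2 *: v - u) (y - o) <= 0 -> sq (o - y) <= s ^+ 2.
    rewrite !dot2B => su sv uv ut vt h1 h2; apply: le_trans ty; rewrite sqC.
    rewrite (_ : t - y = (t - o) - (y - o)); last by rewrite opprB addrA subrK.
    apply: (nearest_vertex d0 su sv uv) => //.
      by rewrite (_ : t - o - u = - (o + u - t)) ?sN//; rewrite opprB opprD addrA.
    by rewrite (_ : t - o - v = - (o + v - t)) ?sN//; rewrite opprB opprD addrA.
  have p12 : p2 - a = p1 by rewrite p2E addrK.
  have p13 : p3 - b = p1 by rewrite p3E addrK.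
  have p23 : p2 + (b - a) = p3 by rewrite p2E p3E addrACA subrr addr0.
  have p32 : p3 + (a - b) = p2 by rewrite p2E p3E addrACA subrr addr0.
  have [a0|a0] := leP 0 (la y); have [b0|b0] := leP 0 (lb y); have [c0|c0] := leP 0 (lc y).
  - by left; apply/TrP.
  - right; left; split; first by apply/S1P; split=> //; exact: in1.
    by move=> /TrP[_ _]; rewrite leNgt c0.
  - right; right; right; left; split; first by apply/S3P; split=> //; exact: in1.
    by move=> /TrP[_]; rewrite leNgt b0.
  - do 5 right; left; apply/N2P; split; [exact: ltW|exact: ltW|].
    apply: (near p2 (- a) (b - a)) => //; rewrite ?sN ?p12 ?p23 ?S2e ?S2e'//; exact: ltW.
  - right; right; left; split; first by apply/S2P; split=> //; exact: in1.
    by move=> /TrP[]; rewrite leNgt a0.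
  - do 6 right; apply/N3P; split; [exact: ltW|exact: ltW|].
    apply: (near p3 (- b) (a - b)) => //; rewrite ?sN ?p13 ?p32 ?S3e ?S3e'//; exact: ltW.
  - do 4 right; left; apply/N1P; split; [exact: ltW|exact: ltW|].
    apply: (near p1 a b) => //; rewrite -?p2E -?p3E ?dot2B//; exact: ltW.
  - have : 0 < d ^+ 2 by rewrite exprn_gt0.
    by move: a0 b0 c0; rewrite /la /lb /lc; lra.
have [aS1 aS2 aS3] : [/\ rarea S1 = pi / 6, rarea S2 = pi / 6 & rarea S3 = pi / 6].
  by split; rewrite (rarea_sector _ d0 ltr01) ?sN// expr1n mul1r.
have [aN1 aN2 aN3] : [/\ rarea N1 = s ^+ 2 * (pi / 6), rarea N2 = s ^+ 2 * (pi / 6) &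
    rarea N3 = s ^+ 2 * (pi / 6)].
  split; apply: (rarea_sector _ d0 s0); rewrite ?sN ?dNN//.
    have -> : dot a (a - b) = sq a - dot a b by rewrite /sq/dot/=; ring.
    by rewrite sa ab; field.
  have -> : dot b (b - a) = sq b - dot a b by rewrite /sq/dot/=; ring.
  by rewrite sb ab; field.
have aT := rarea_triangle p1 d0 sa sb ab.
have cT := @compact_triangle d p1 a b d0 sa sb ab.
have cS o u v : compact (sector o u v 1) by exact: compact_sector.
have cN o u v : compact (sector o u v s) by apply: compact_sector; exact: ltW.
have aD S : compact S -> Tr `<=` S -> rarea S = pi / 6 ->
    measurable (S `\` Tr) /\ area (S `\` Tr) = (pi / 6 - rarea Tr)%:E.
  move=> cS' TS aS; have mS := compact_measurable_plane cS'.
  split; first by apply: measurableD => //; exact: compact_measurable_plane.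
  have := areaD mS cT TS; rewrite rareaE// aS.
  by case: (area _) => [r| |] // -[->]; rewrite addrAC subrr add0r.
have [mD1 aD1] := aD _ (cS _ _ _) TS1 aS1.
have [mD2 aD2] := aD _ (cS _ _ _) TS2 aS2.
have [mD3 aD3] := aD _ (cS _ _ _) TS3 aS3.
have mD : measurable D.
  have cT' : compact T.
    rewrite TE !diskB ?ltW//; apply: (@subclosed_compact _ _ [set y | sq (p1 - y) <= d ^+ 2]).
    - by apply: closedI; [apply: closedI|]; exact: closed_sq_ball.
    - exact/compact_sq_ball/ltW.
    - by move=> y [[]].
  have [_ cB _] := body_disk0 (ltW s0).
  suff -> : D = minkowski_sum T (disk0 s) by apply: compact_measurable_plane; exact: compact_minkowski_sum.
  have sqC x z : sq (x - z) = sq (z - x) by rewrite /sq/dot/=; ring.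
  rewrite DE; apply/seteqP; split=> y.
    move=> [t Tt] /(diskE _ _ (ltW s0)) ty; exists t => //; exists (y - t).
      by rewrite /disk0/= sqC.
    by rewrite addrC subrK.
  move=> [t Tt [z Bz ->]]; exists t => //; apply/(diskE _ _ (ltW s0)).
  by rewrite sqC addrC addKr.
have mN o u v : measurable (sector o u v s) by apply: compact_measurable_plane; exact: cN.
have leU X Y (e f : R) : measurable X -> (area X <= e%:E)%E -> measurable Y /\ (area Y <= f%:E)%E ->
    measurable (X `|` Y) /\ (area (X `|` Y) <= (e + f)%:E)%E.
  move=> mX Xe [mY Yf]; split; first exact: measurableU.
  by apply: le_trans (leeD Xe Yf); exact: measureU2.
have aE X (e : R) : compact X -> rarea X = e -> (area X <= e%:E)%E by move=> cX <-; rewrite rareaE.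
have [mC leC] : measurable
      (Tr `|` ((S1 `\` Tr) `|` ((S2 `\` Tr) `|` ((S3 `\` Tr) `|` (N1 `|` (N2 `|` N3)))))) /\
   (area (Tr `|` ((S1 `\` Tr) `|` ((S2 `\` Tr) `|` ((S3 `\` Tr) `|` (N1 `|` (N2 `|` N3)))))) <=
    (rarea Tr + ((pi / 6 - rarea Tr) + ((pi / 6 - rarea Tr) + ((pi / 6 - rarea Tr) +
      (s ^+ 2 * (pi / 6) + (s ^+ 2 * (pi / 6) + s ^+ 2 * (pi / 6)))))))%:E)%E.
  apply: (leU _ _); [exact: compact_measurable_plane|exact: aE|].
  apply: (leU _ _); [exact: mD1|by rewrite aD1|].
  apply: (leU _ _); [exact: mD2|by rewrite aD2|].
  apply: (leU _ _); [exact: mD3|by rewrite aD3|].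
  apply: (leU _ _); [exact: mN|exact: (aE _ _ (cN _ _ _) aN1)|].
  apply: (leU _ _); [exact: mN|exact: (aE _ _ (cN _ _ _) aN2)|].
  by split; [exact: mN|exact: (aE _ _ (cN _ _ _) aN3)].
apply: (@le_trans _ _
    (area (Tr `|` ((S1 `\` Tr) `|` ((S2 `\` Tr) `|` ((S3 `\` Tr) `|` (N1 `|` (N2 `|` N3)))))))).
  by apply: le_measure; rewrite ?inE.
apply: le_trans leC _; rewrite lee_fin; exact: total aT.
Qed.

End RoundedReuleaux.

Unset Implicit Arguments.
Set Strict Implicit.

Theorem theorem1p12 (R : realType) (d : R) (hd0 : 0 < d) (hd1 : d < 1)
    (D : set (R * R)) (hD : disk_polygons_with_center_parameter d D)
    (Delta : set (R * R)) (hDelta : rounded_reuleaux d Delta) :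
  (area Delta < area D)%E.
Proof.
have d01 : 0 < d < 1 by rewrite hd0.
exact: le_lt_trans (area_rounded_reuleaux d01 hDelta) (area_disk_polygon_gt d01 hD).
Qed.
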